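(* For $0\le p\le 6$ let $N_3(p,6-p)$ denote the number of generic arrangements of $3$ lines in $\mathbb{P}^2$ that pass through $p$ points and are tangent to $6-p$ lines, where the $p$ points and $6-p$ lines are in general position. Then $$N_3(0,6)=15,\quad N_3(1,5)=30,\quad N_3(2,4)=48,\quad N_3(3,3)=57,\quad N_3(4,2)=48,\quad N_3(5,1)=30,\quad N_3(6,0)=15.$$
   Context: All varieties are over $\mathbb{C}$. A line arrangement is a finite (unordered) set of distinct lines in $\mathbb{P}^2$. An arrangement of $k$ lines in $\mathbb{P}^2$ is generic if $k>2$ and no point lies on more than two of the lines. The space of generic arrangements of $3$ lines has dimension $6$. An arrangement passes through a point $P$ if $P$ lies on at least one of its lines. A generic arrangement $\{\ell_1,\ldots,\ell_k\}$ is tangent to a line $L$ if the curve $\ell_1\cup\cdots\cup\ell_k$ meets $L$ at a point with multiplicity strictly greater than $1$; equivalently, if some intersection point $\ell_i\cap\ell_j$ ($i\neq j$) lies on $L$. ''In general position'' means that the tuple of given points and lines is general, i.e. lies in a suitable nonempty Zariski-open subset of $(\mathbb{P}^2)^p\times(\mathbb{P}^{2*})^{6-p}$, where $\mathbb{P}^{2*}$ is the dual plane of lines in $\mathbb{P}^2$; for such tuples the number of arrangements is finite and independent of the choice. *)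

(* Defs.v *)
From HB Require Import structures.
From mathcomp Require Import all_boot all_order all_algebra.
From mathcomp Require Import finmap complex mpoly reals.

Set Implicit Arguments.
Unset Strict Implicit.
Unset Printing Implicit Defensive.

Import GRing.Theory.
Local Open Scope ring_scope.

Section ProjectiveSpace.
Variables (K : fieldType) (V : vectType K).

(* P(V): the one-dimensional subspaces of V. *)
Record proj_space :=
  ProjSpace { subspace_of :> {vspace V}; _ : \dim subspace_of == 1%N }.

HB.instance Definition _ := [isSub for subspace_of].
HB.instance Definition _ := [Choice of proj_space by <:].

(* A choice of homogeneous coordinates: a nonzero vector of the subspace.
   Everything below is independent of this choice. *)
Definition rep (P : proj_space) : V := vpick P.

End ProjectiveSpace.

Section PlaneGeometry.
Variable K : fieldType.

Definition plane := proj_space 'rV[K]_3.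

(* The dual plane: the line with equation a_0 x_0 + a_1 x_1 + a_2 x_2 = 0 is
   the point [a_0 : a_1 : a_2] of the projective space of linear forms. *)
Definition line := proj_space 'cV[K]_3.

Definition on_line (P : plane) (l : line) : bool := rep P *m rep l == 0.

Definition line_eqn (l : line) : {mpoly K[3]} :=
  \sum_(j < 3) rep l j 0 *: 'X_j.

Definition arrangement_eqn (A : {fset line}) : {mpoly K[3]} :=
  \prod_(l <- A) line_eqn l.

(* The one-variable polynomial F (v + t w). *)
Definition line_restriction (F : {mpoly K[3]}) (v w : 'rV[K]_3) : {poly K} :=
  mmap polyC (fun j => (v 0 j)%:P + w 0 j *: 'X) F.

(* For a homogeneous F, the curve F = 0 meets the line L at P in L with
   multiplicity at least m: F restricted to L vanishes at P to order at least
   m. The line L is parametrized by P + t Q, with Q any other point of L; the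
   order at t = 0 does not depend on Q. If F vanishes identically on L then
   the multiplicity is infinite. *)
Definition inter_mult_ge (F : {mpoly K[3]}) (L : line) (P : plane) (m : nat) :=
  exists Q : plane, [/\ on_line Q L, Q != P
    & 'X^m %| line_restriction F (rep P) (rep Q)].

Definition generic_arrangement (k : nat) (A : {fset line}) :=
  [/\ #|` A|%fset = k, (2 < k)%N
    & forall P : plane, (#|` [fset l in A | on_line P l]|%fset <= 2)%N].

Definition passes_through (A : {fset line}) (P : plane) :=
  exists2 l, l \in A & on_line P l.

Definition tangent_to (A : {fset line}) (L : line) :=
  exists2 P, on_line P L & inter_mult_ge (arrangement_eqn A) L P 2.

Definition config (p q : nat) := (p.-tuple plane * q.-tuple line)%type.

Section Zariski.
Variables p q : nat.

Definition coords (x : config p q) : 'M[K]_(p + q, 3) :=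
  col_mx (\matrix_i rep (tnth x.1 i)) (\matrix_i (rep (tnth x.2 i))^T).

(* The variable of index mxvec_index i j is the j-th homogeneous coordinate on
   the i-th factor. *)
Definition multihomogeneous (F : {mpoly K[(p + q) * 3]}) :=
  exists d : 'I_(p + q) -> nat, forall m, m \in msupp F ->
    forall i, (\sum_(j < 3) m (mxvec_index i j))%N = d i.

Definition vanishes_at (F : {mpoly K[(p + q) * 3]}) (x : config p q) :=
  F.@[fun k => mxvec (coords x) 0 k] = 0.

Definition zariski_closed (Z : config p q -> Prop) :=
  exists S : {mpoly K[(p + q) * 3]} -> Prop,
    (forall F, S F -> multihomogeneous F) /\
    (forall x, Z x <-> forall F, S F -> vanishes_at F x).

Definition zariski_open (U : config p q -> Prop) :=
  zariski_closed (fun x => ~ U x).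

Definition for_general_config (Q : config p q -> Prop) :=
  exists U, [/\ zariski_open U, exists x, U x & forall x, U x -> Q x].

End Zariski.

Definition solution (k p q : nat) (x : config p q) (A : {fset line}) :=
  [/\ generic_arrangement k A,
      forall P, P \in x.1 -> passes_through A P
    & forall L, L \in x.2 -> tangent_to A L].

Definition number_of (T : choiceType) (Q : T -> Prop) (N : nat) :=
  exists S : {fset T}, (forall A, A \in S <-> Q A) /\ #|` S|%fset = N.

(* N_k(p, q) = N *)
Definition characteristic_number (k p q N : nat) :=
  for_general_config (fun x : config p q => number_of (solution k x) N).

End PlaneGeometry.

(* Main.v *)
Require Import Defs.
From HB Require Import structures.
From mathcomp Require Import all_boot all_order all_algebra.
From mathcomp Require Import finmap complex mpoly reals.
From mathcomp Require Import ring ssrZ.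

(* A solution is a triangle with, for each given point, a side through it and,
   for each given line, a vertex on it. Fix such an assignment of the six data
   to the three sides and three vertices of a labelled triangle. The triangle
   has six parameters, and drawing sides and vertices one after the other as
   joins and meets of things already known either determines it rationally, or
   overdetermines some side or vertex, so that no triangle exists for general
   data, or cannot start at all. The last case occurs only when every side and
   every vertex carries exactly one datum; moving one vertex along its line and
   drawing the rest then closes up for the roots of a quadratic polynomial, so
   there are two triangles. Hence the number of solutions is the number of
   rational assignments plus twice the number of quadratic ones, up to
   relabelling. The 3^6 assignments are run through a verified solver, and
   genericity is the nonvanishing of an explicit product of multihomogeneous
   polynomials, which is checked at one integral configuration. *)

Set Implicit Arguments.
Unset Strict Implicit.
Unset Printing Implicit Defensive.

Import GRing.Theory Num.Theory.
Local Open Scope ring_scope.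

(** * Vectors with three coordinates, serving for points and for lines *)

Definition vec (R : Type) : Type := (R * R * R)%type.

Definition vmap (R S : Type) (f : R -> S) (u : vec R) : vec S :=
  (f u.1.1, f u.1.2, f u.2).

Section Vectors.
Variable R : comNzRingType.
Implicit Types u v w : vec R.

Definition dot u v : R := u.1.1 * v.1.1 + u.1.2 * v.1.2 + u.2 * v.2.

Definition cross u v : vec R :=
  (u.1.2 * v.2 - u.2 * v.1.2, u.2 * v.1.1 - u.1.1 * v.2,
   u.1.1 * v.1.2 - u.1.2 * v.1.1).

Definition scale (c : R) u : vec R := vmap ( *%R c) u.

(** An affine coordinate [z] on the pencil spanned by [u] and [v]; the member [u] itself sits at
    infinity. *)
Definition comb (z : R) u v : vec R :=
  (z * u.1.1 + v.1.1, z * u.1.2 + v.1.2, z * u.2 + v.2).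

Lemma dotC u v : dot u v = dot v u.
Proof. by rewrite /dot; ring. Qed.

Lemma dot_cross_l u v : dot u (cross u v) = 0.
Proof. by rewrite /dot /cross /=; ring. Qed.

Lemma dot_cross_r u v : dot v (cross u v) = 0.
Proof. by rewrite /dot /cross /=; ring. Qed.

Lemma dot_cross_rot u v w : dot w (cross u v) = dot u (cross v w).
Proof. by rewrite /dot /cross /=; ring. Qed.

Lemma dotZl c u v : dot (scale c u) v = c * dot u v.
Proof. by rewrite /dot /=; ring. Qed.

Lemma dotZr c u v : dot u (scale c v) = c * dot u v.
Proof. by rewrite /dot /=; ring. Qed.

Lemma crossZ a b u v :
  cross (scale a u) (scale b v) = scale (a * b) (cross u v).
Proof. by rewrite /cross /scale /vmap /=; do 2?congr pair; ring. Qed.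

Lemma scale1 u : scale 1 u = u.
Proof. by case: u => [[a b] c]; rewrite /scale /vmap /= !mul1r. Qed.

Lemma scaleA a b u : scale a (scale b u) = scale (a * b) u.
Proof. by rewrite /scale /vmap /= !mulrA. Qed.

Lemma scale_comb a z u v :
  scale a (comb z u v) = comb (a * z) u (scale a v).
Proof. by rewrite /scale /comb /vmap /=; do 2?congr pair; ring. Qed.

Lemma dot_combl z u v w : dot (comb z u v) w = z * dot u w + dot v w.
Proof. by rewrite /dot /=; ring. Qed.

Lemma dot_combr z u v w : dot w (comb z u v) = z * dot w u + dot w v.
Proof. by rewrite /dot /=; ring. Qed.

Lemma cross_combl z u v w :
  cross (comb z u v) w = comb z (cross u w) (cross v w).
Proof. by rewrite /cross /comb /=; do 2?congr pair; ring. Qed.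

Lemma cross0l u : cross 0 u = 0.
Proof. by rewrite /cross /= !mul0r subrr. Qed.

Lemma cross0r u : cross u 0 = 0.
Proof. by rewrite /cross /= !mulr0 subrr. Qed.

Lemma dot0l u : dot 0 u = 0.
Proof. by rewrite /dot /= !mul0r !addr0. Qed.

Lemma dot0r u : dot u 0 = 0.
Proof. by rewrite dotC dot0l. Qed.

Lemma dot_neq0 u v : dot u v != 0 -> (u != 0) && (v != 0).
Proof.
move=> h; apply/andP; split; apply: contraNneq h => ->.
  by rewrite dot0l.
by rewrite dot0r.
Qed.

Lemma cross_neq0 u v : cross u v != 0 -> (u != 0) && (v != 0).
Proof.
move=> h; apply/andP; split; apply: contraNneq h => ->.
  by rewrite cross0l.
by rewrite cross0r.
Qed.

End Vectors.

Lemma vmap_dot (R S : comNzRingType) (f : {rmorphism R -> S}) (u v : vec R) :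
  dot (vmap f u) (vmap f v) = f (dot u v).
Proof. by rewrite /dot !rmorphD !rmorphM. Qed.

Lemma vmap_cross (R S : comNzRingType) (f : {rmorphism R -> S}) (u v : vec R) :
  cross (vmap f u) (vmap f v) = vmap f (cross u v).
Proof. by rewrite /cross /vmap /= !rmorphB !rmorphM. Qed.

Section Proportional.
Variable K : fieldType.
Implicit Types u v w : vec K.

Definition proportional u v := exists2 c, c != 0 & u = scale c v.

Lemma prop_refl u : proportional u u.
Proof. by exists 1; rewrite ?oner_eq0 ?scale1. Qed.

Lemma prop_sym u v : proportional u v -> proportional v u.
Proof.
by case=> c c0 ->; exists c^-1; rewrite ?invr_eq0 // scaleA mulVf // scale1.
Qed.

Lemma prop_trans v u w :
  proportional u v -> proportional v w -> proportional u w.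
Proof.
by case=> c c0 -> [d d0 ->]; exists (c * d); rewrite ?scaleA // mulf_neq0.
Qed.

Lemma prop_dot0 u v w : proportional u v -> (dot u w == 0) = (dot v w == 0).
Proof. by case=> c c0 ->; rewrite dotZl mulf_eq0 (negPf c0). Qed.

Lemma prop_dot0r u v w : proportional u v -> (dot w u == 0) = (dot w v == 0).
Proof. by rewrite !(dotC w); apply: prop_dot0. Qed.

Lemma scale_eq0 c u : c != 0 -> (scale c u == 0) = (u == 0).
Proof.
case: u => [[u1 u2] u3] c0.
by rewrite /scale /vmap !xpair_eqE /= !mulf_eq0 (negPf c0).
Qed.

Lemma prop_eq0 u v : proportional u v -> (u == 0) = (v == 0).
Proof. by case=> c c0 ->; rewrite scale_eq0. Qed.

Lemma cross0_prop u w : cross u w = 0 -> u != 0 -> w != 0 -> proportional u w.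
Proof.
case: u w => [[u1 u2] u3] [[w1 w2] w3]; rewrite /cross /= => -[e1 e2 e3].
rewrite !xpair_eqE => u0 w0.
have e1' : u2 * w3 = u3 * w2 by apply/eqP; rewrite -subr_eq0; apply/eqP.
have e2' : u3 * w1 = u1 * w3 by apply/eqP; rewrite -subr_eq0; apply/eqP.
have e3' : u1 * w2 = u2 * w1 by apply/eqP; rewrite -subr_eq0; apply/eqP.
suff [c ec] : exists c, (u1, u2, u3) = scale c (w1, w2, w3).
  exists c; last exact: ec.
  apply: contraNneq u0 => c0; move: ec; rewrite /scale /vmap /= c0 !mul0r.
  by case=> -> -> ->; rewrite !eqxx.
have [z1|n1] := eqVneq w1 0; last first.
  exists (u1 / w1); rewrite /scale /vmap /=.
  have -> : u2 = u1 / w1 * w2 by rewrite mulrAC e3' mulfK.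
  have -> : u3 = u1 / w1 * w3 by rewrite mulrAC -e2' mulfK.
  by rewrite divfK.
have [z2|n2] := eqVneq w2 0; last first.
  exists (u2 / w2); rewrite /scale /vmap /=.
  have -> : u1 = u2 / w2 * w1 by rewrite mulrAC -e3' mulfK.
  have -> : u3 = u2 / w2 * w3 by rewrite mulrAC e1' mulfK.
  by rewrite divfK.
have n3 : w3 != 0 by move: w0; rewrite z1 z2 !eqxx.
exists (u3 / w3); rewrite /scale /vmap /=.
have -> : u1 = u3 / w3 * w1 by rewrite mulrAC e2' mulfK.
have -> : u2 = u3 / w3 * w2 by rewrite mulrAC -e1' mulfK.
by rewrite divfK.
Qed.

(** The expansion of the triple product [cross u (cross v w)] has coefficients [dot u v] and
    [dot u w]. Geometrically, an object incident with two distinct known ones is their join or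
    meet. *)
Lemma orthogonal_prop u v w : u != 0 -> dot u v = 0 -> dot u w = 0 ->
  cross v w != 0 -> proportional u (cross v w).
Proof.
move=> u0 uv uw vw; apply: cross0_prop => //.
have -> : cross u (cross v w) = comb (- dot u v) w (scale (dot u w) v).
  by rewrite /cross /comb /dot /scale /vmap /=; do 2?congr pair; ring.
by rewrite uv uw /comb /= !(oppr0, mul0r, addr0).
Qed.

End Proportional.

(** * Formal expressions in the data *)

Inductive vexpr := VIn of nat | VCross of vexpr & vexpr.

(** Kept as syntax, so that one and the same expression can be inspected for its shape and
    multidegree and evaluated in the field, at polynomial variables and at integers. *)
Inductive sexpr :=
  | SDot of vexpr & vexpr
  | SMul of sexpr & sexpr
  | SAdd of sexpr & sexpr
  | SSub of sexpr & sexpr.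

Section Eval.
Variables (R : comNzRingType) (x : nat -> vec R).

Fixpoint veval e : vec R :=
  match e with VIn i => x i | VCross a b => cross (veval a) (veval b) end.

Fixpoint seval s : R :=
  match s with
  | SDot a b => dot (veval a) (veval b)
  | SMul s t => seval s * seval t
  | SAdd s t => seval s + seval t
  | SSub s t => seval s - seval t
  end.

End Eval.

Lemma veval_morph (R S : comNzRingType) (f : {rmorphism R -> S}) x e :
  veval (fun i => vmap f (x i)) e = vmap f (veval x e).
Proof. by elim: e => //= a -> b ->; rewrite vmap_cross. Qed.

Lemma seval_morph (R S : comNzRingType) (f : {rmorphism R -> S}) x s :
  seval (fun i => vmap f (x i)) s = f (seval x s).
Proof.
elim: s => /= [a b|s -> t ->|s -> t ->|s -> t ->].
- by rewrite !veval_morph vmap_dot.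
- by rewrite rmorphM.
- by rewrite rmorphD.
- by rewrite rmorphB.
Qed.

Lemma eq_veval (R : comNzRingType) (x y : nat -> vec R) :
  x =1 y -> veval x =1 veval y.
Proof. by move=> xy; elim=> //= a -> b ->. Qed.

Lemma eq_seval (R : comNzRingType) (x y : nat -> vec R) :
  x =1 y -> seval x =1 seval y.
Proof.
by move=> xy; elim=> /= [a b|s -> t ->|s -> t ->|s -> t ->] //;
  rewrite !(eq_veval xy).
Qed.

(* The multiset of inputs of an expression encodes its multidegree. For a sum
   only one summand is read: multihomog checks that both agree. *)
Fixpoint vleaves e :=
  match e with VIn i => [:: i] | VCross a b => vleaves a ++ vleaves b end.

Fixpoint sleaves s :=
  match s with
  | SDot a b => vleaves a ++ vleaves b
  | SMul s t => sleaves s ++ sleaves t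
  | SAdd s t => sleaves s
  | SSub s t => sleaves s
  end.

Fixpoint multihomog s :=
  match s with
  | SDot a b => true
  | SMul s t => multihomog s && multihomog t
  | SAdd s t | SSub s t =>
      [&& multihomog s, multihomog t & perm_eq (sleaves s) (sleaves t)]
  end.

Section Scaling.
Variables (R : comNzRingType) (c : nat -> R) (x : nat -> vec R).

Lemma veval_scale e :
  veval (fun i => scale (c i) (x i)) e =
  scale (\prod_(i <- vleaves e) c i) (veval x e).
Proof.
elim: e => /= [i|a -> b ->]; first by rewrite big_seq1.
by rewrite crossZ big_cat.
Qed.

(** Rescaling the data multiplies the value by a monomial in the factors, so nonvanishing is a
    property of the points and lines and not of their coordinates. *)
Lemma seval_scale s : multihomog s ->
  seval (fun i => scale (c i) (x i)) s =
  (\prod_(i <- sleaves s) c i) * seval x s.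
Proof.
elim: s => /= [a b _|s IHs t IHt|s IHs t IHt|s IHs t IHt].
- by rewrite !veval_scale dotZl dotZr big_cat mulrA.
- by case/andP=> /IHs-> /IHt->; rewrite big_cat mulrACA.
- by case/and3P=> /IHs-> /IHt-> st; rewrite (perm_big _ st) mulrDr.
- by case/and3P=> /IHs-> /IHt-> st; rewrite (perm_big _ st) mulrBr.
Qed.

End Scaling.

(** * Multidegrees of the polynomials obtained from expressions *)

Section Multidegree.
Variables (K : fieldType) (n : nat).

Definition has_mdeg (F : {mpoly K[n * 3]}) (l : seq nat) :=
  forall m, m \in msupp F -> forall i : 'I_n,
    (\sum_(j < 3) m (mxvec_index i j))%N = count_mem (val i) l.

(** An index out of range gives the zero vector, whose coordinates have every multidegree
    vacuously. *)
Definition vvars (i : nat) : vec {mpoly K[n * 3]} :=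
  if insub i : option 'I_n is Some i' then
    ('X_(mxvec_index i' 0), 'X_(mxvec_index i' 1),
     'X_(mxvec_index i' (lift 0 1)))
  else 0.

Lemma mdeg0 l : has_mdeg 0 l.
Proof. by move=> m; rewrite msupp0. Qed.

Lemma mdegD F G l : has_mdeg F l -> has_mdeg G l -> has_mdeg (F + G) l.
Proof.
by move=> hF hG m /msuppD_le; rewrite mem_cat => /orP[/hF|/hG].
Qed.

Lemma mdegB F G l : has_mdeg F l -> has_mdeg G l -> has_mdeg (F - G) l.
Proof.
by move=> hF hG m /msuppB_le; rewrite mem_cat => /orP[/hF|/hG].
Qed.

Lemma mdegM F G l k :
  has_mdeg F l -> has_mdeg G k -> has_mdeg (F * G) (l ++ k).
Proof.
move=> hF hG m /msuppM_le /allpairsP[[m1 m2] /= [h1 h2 ->]] i.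
rewrite count_cat -(hF _ h1) -(hG _ h2) -big_split /=.
by apply: eq_bigr => j _; rewrite mnmDE.
Qed.

Lemma mdeg_perm F l k : perm_eq l k -> has_mdeg F l -> has_mdeg F k.
Proof. by move=> /permP lk hF m /hF h i; rewrite h lk. Qed.

Lemma mxvec_index_eq m1 m2 (i i' : 'I_m1) (j j' : 'I_m2) :
  (mxvec_index i j == mxvec_index i' j') = (i == i') && (j == j').
Proof.
case: (curry_mxvec_bij m1 m2) => g gK _; rewrite -xpair_eqE.
by rewrite -(inj_eq (can_inj (fun ij => gK ij isT))).
Qed.

Lemma mdegX (i : 'I_n) j : has_mdeg 'X_(mxvec_index i j) [:: val i].
Proof.
move=> m; rewrite msuppX inE => /eqP-> i'; rewrite /= addn0.
under eq_bigr do rewrite mnm1E mxvec_index_eq.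
rewrite -[RHS]/(nat_of_bool (i == i')); case: eqP => _ /=; last by rewrite big1.
by rewrite (bigD1 j) //= eqxx big1 // => k kj; rewrite eq_sym (negPf kj).
Qed.

Definition vhas_mdeg (u : vec {mpoly K[n * 3]}) l :=
  [/\ has_mdeg u.1.1 l, has_mdeg u.1.2 l & has_mdeg u.2 l].

Lemma veval_mdeg e : vhas_mdeg (veval vvars e) (vleaves e).
Proof.
elim: e => /= [i|a [a1 a2 a3] b [b1 b2 b3]].
  rewrite /vvars; case: insubP => [i' _ <-|_]; split; rewrite /=;
    try exact: mdegX; exact: mdeg0.
by split; rewrite /=; apply: mdegB; apply: mdegM.
Qed.

Lemma seval_mdeg s : multihomog s -> has_mdeg (seval vvars s) (sleaves s).
Proof.
elim: s => /= [a b _|s IHs t IHt|s IHs t IHt|s IHs t IHt].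
- have [a1 a2 a3] := veval_mdeg a; have [b1 b2 b3] := veval_mdeg b.
  by apply: mdegD; [apply: mdegD|]; apply: mdegM.
- by case/andP=> /IHs hs /IHt ht; apply: mdegM.
- case/and3P=> /IHs hs /IHt ht st; apply: mdegD => //.
  by apply: mdeg_perm ht; rewrite perm_sym.
- case/and3P=> /IHs hs /IHt ht st; apply: mdegB => //.
  by apply: mdeg_perm ht; rewrite perm_sym.
Qed.

End Multidegree.

(** * Labelled triangles and the solver *)

Fixpoint veq (a b : vexpr) : bool :=
  match a, b with
  | VIn i, VIn j => i == j
  | VCross a1 a2, VCross b1 b2 => veq a1 b1 && veq a2 b2
  | _, _ => false
  end.

Lemma veqP : Equality.axiom veq.
Proof.
elim=> [i|a IHa b IHb] [j|c d] /=; try by right.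
  by apply: (iffP eqP) => [->|[->]].
by apply: (iffP andP) => [[/IHa-> /IHb->]|[<- <-]]; do ?split;
  apply/IHa || apply/IHb.
Qed.

HB.instance Definition _ := hasDecEq.Build vexpr veqP.

Lemma sexpr_comparable : comparable sexpr.
Proof.
by rewrite /comparable /decidable; decide equality; apply: eq_comparable.
Qed.

HB.instance Definition _ := hasDecEq.Build sexpr (compareP sexpr_comparable).

(* A labelled triangle is a function on 0..5: the side i is o i and the vertex
   opposite to it is o (3 + i), for i < 3. *)
Definition triangle (K : fieldType) (o : nat -> vec K) :=
  forall i j, (i < 3)%N -> (j < 3)%N ->
    (dot (o i) (o (3 + j)%N) == 0) = (i != j).

(* An assignment t sends the i-th of the six data to the side or vertex which
   is incident with it. *)
Definition meets (K : fieldType) (x : nat -> vec K) (t : seq nat)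
    (o : nat -> vec K) :=
  forall i, (i < 6)%N -> dot (x i) (o (nth 0%N t i)) = 0.

Definition similar (K : fieldType) (o o' : nat -> vec K) :=
  forall k, (k < 6)%N -> proportional (o k) (o' k).

(** The incidences of a triangle form a hexagon: side [i] misses only the vertex [3 + i]. *)
Definition adj (k : nat) : seq nat :=
  if (k < 3)%N then [seq (3 + j)%N | j <- iota 0 3 & j != k]
  else [seq j <- iota 0 3 | j != (k - 3)%N].

Definition state := seq (nat * vexpr).

Definition known (t : seq nat) (st : state) (k : nat) : seq vexpr :=
  [seq VIn i | i <- iota 0 6 & nth 0%N t i == k] ++
  [seq s.2 | s <- st & s.1 \in adj k].

Definition ready (t : seq nat) (st : state) : seq nat :=
  [seq k <- iota 0 6 | (k \notin unzip1 st) && (1 < size (known t st k))%N].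

(** [Contradiction s] records an equation [s = 0] that any triangle realising the assignment forces
    on the data. [Stuck] means that no remaining object has two known incidences. Fuel counts the
    objects still to be drawn, so with fuel 6 and an empty state [Solved] means that all six are
    drawn. *)
Inductive outcome :=
  Contradiction of sexpr | Solved of state | Stuck.

(* A side or vertex is determined by any two of its known incident vertices,
   points, sides or lines; a third known one overdetermines it. *)
Fixpoint solve (t : seq nat) (fuel : nat) (st : state) : outcome :=
  if fuel is f.+1 then
    if ready t st is k :: _ then
      match known t st k with
      | [:: a; b] => solve t f ((k, VCross a b) :: st)
      | a :: b :: c :: _ => Contradiction (SDot c (VCross a b))
      | _ => Stuck
      end
    else Stuck
  else Solved st.

Definition lookup (st : state) (k : nat) : vexpr :=
  nth (VIn 0) [seq s.2 | s <- st & s.1 == k] 0.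

(** A syntactic certificate of incidence: a cross product is orthogonal to its factors whatever the
    data are. *)
Definition factor_of (a b : vexpr) : bool :=
  if b is VCross b1 b2 then (a == b1) || (a == b2) else false.

Definition incident (a b : vexpr) : bool := factor_of a b || factor_of b a.

(* Since the 12 incidences match the 12 parameters of the six objects, a
   completed construction uses each incidence exactly once, so that all of them
   hold by construction. *)
Definition solved_ok (t : seq nat) (st : state) : bool :=
  [&& all (fun i => factor_of (VIn i) (lookup st (nth 0%N t i))) (iota 0 6),
      all (fun i => all (fun j =>
        (i == j) || incident (lookup st i) (lookup st (3 + j))) (iota 0 3))
        (iota 0 3)
    & all (fun k => k \in unzip1 st) (iota 0 6)].

Definition targets (p i : nat) : seq nat :=
  if (i < p)%N then iota 0 3 else iota 3 3.

(** When none of these vanishes, each datum meets the triangle only where [t] puts it, so the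
    labelled triangle belongs to no other assignment. *)
Definition nonincidences (p : nat) (t : seq nat) (e : nat -> vexpr) :=
  [seq SDot (VIn i) (e k) | i <- iota 0 6,
     k <- [seq k <- targets p i | k != nth 0%N t i]].

Definition solved_conds (p : nat) (t : seq nat) (st : state) : seq sexpr :=
  [seq SDot (lookup st i) (lookup st (3 + i)) | i <- iota 0 3] ++
  nonincidences p t (lookup st).

Section Solver.
Variables (K : fieldType) (x : nat -> vec K).

Lemma triangle_neq0 (o : nat -> vec K) k :
  triangle o -> (k < 6)%N -> o k != 0.
Proof.
move=> ho; have main i : (i < 3)%N -> (o i != 0) && (o (3 + i)%N != 0).
  by move=> i3; apply: dot_neq0; rewrite (ho _ _ i3 i3) eqxx.
case: (ltnP k 3) => [/main/andP[] // | k3 k6].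
have /main/andP[_] : (k - 3 < 3)%N by rewrite ltn_subLR.
by rewrite subnKC.
Qed.

Lemma triangle_adj (o : nat -> vec K) k j :
  triangle o -> (k < 6)%N -> j \in adj k -> dot (o k) (o j) = 0.
Proof.
move=> ho k6; rewrite /adj; case: ltnP => k3.
  case/mapP=> i; rewrite mem_filter mem_iota => /andP[ik i3] ->.
  by apply/eqP; rewrite ho // eq_sym.
rewrite mem_filter mem_iota => /andP[jk j3].
have k63 : (k - 3 < 3)%N by rewrite ltn_subLR.
by apply/eqP; rewrite dotC -[k](subnKC k3) ho.
Qed.

(** A degenerate join or meet evaluates to 0 and says nothing about [o], hence the guard. *)
Definition derived (o : nat -> vec K) (st : state) :=
  forall s, s \in st -> veval x s.2 != 0 ->
    proportional (o s.1) (veval x s.2).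

Lemma known_dot0 t (o : nat -> vec K) st k a :
  triangle o -> meets x t o -> derived o st -> (k < 6)%N ->
  a \in known t st k -> veval x a != 0 -> dot (o k) (veval x a) = 0.
Proof.
move=> ho ht hst k6; rewrite /known mem_cat => /orP[] /mapP[e he ->].
  move: he; rewrite mem_filter mem_iota => /andP[/eqP <- i6] _ /=.
  by rewrite dotC ht.
move: he; rewrite mem_filter => /andP[ek /hst h] /h e0.
by apply/eqP; rewrite -(prop_dot0r _ e0) triangle_adj.
Qed.

Lemma known_cross t (o : nat -> vec K) st k a b :
  triangle o -> meets x t o -> derived o st -> (k < 6)%N ->
  a \in known t st k -> b \in known t st k ->
  veval x (VCross a b) != 0 -> proportional (o k) (veval x (VCross a b)).
Proof.
move=> ho ht hst k6 ka kb ab0; have /andP[a0 b0] := cross_neq0 ab0.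
apply: orthogonal_prop ab0; first exact: triangle_neq0.
  exact: (known_dot0 ho ht hst).
exact: (known_dot0 ho ht hst).
Qed.

(** The construction can be followed on any given triangle realising [t]: an object with two known
    incidences is their cross product unless that is 0, and a third known incidence then becomes an
    equation between the data. *)
Lemma solve_sound t f st (o : nat -> vec K) :
  triangle o -> meets x t o -> derived o st ->
  match solve t f st with
  | Contradiction s => seval x s = 0
  | Solved st' => derived o st'
  | Stuck => True
  end.
Proof.
move=> ho ht; elim: f st => //= f IH st hst.
case ready_k: (ready t st) => [|k ks] //.
have k6 : (k < 6)%N.
  have : k \in k :: ks by rewrite mem_head.
  by rewrite -ready_k mem_filter mem_iota => /andP[].
case hk: (known t st k) => [|a [|b [|c l]]] //; last first.
  (* A nonzero triple product has nonzero factors, so object [k] is [cross a b]; but it is incident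
     with [c], which makes the product 0. *)
  apply/eqP; apply/negPn/negP => /[dup] h /= /dot_neq0 /andP[c0 ab0].
  have hab : proportional (o k) (veval x (VCross a b)).
    by apply: (known_cross ho ht hst k6 _ _ ab0); rewrite // hk !inE eqxx ?orbT.
  case/negP: h; rewrite -(prop_dot0r _ hab) dotC; apply/eqP.
  by apply: (known_dot0 ho ht hst k6 _ c0); rewrite // hk !inE eqxx ?orbT.
apply: IH => s; rewrite inE => /orP[/eqP-> /= ab0|/hst //].
by apply: (known_cross ho ht hst k6 _ _ ab0); rewrite // hk !inE eqxx ?orbT.
Qed.

Lemma lookup_in st k : k \in unzip1 st -> (k, lookup st k) \in st.
Proof.
rewrite /lookup; elim: st => //= -[j e] st IH; rewrite inE eq_sym /=.
by case: eqP => [-> _|_ /= /IH h]; rewrite inE ?eqxx ?h ?orbT.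
Qed.

Lemma factor_of_dot a b : factor_of a b -> dot (veval x a) (veval x b) = 0.
Proof.
case: b => //= b c /orP[]/eqP->; first exact: dot_cross_l.
exact: dot_cross_r.
Qed.

Lemma incident_dot a b : incident a b -> dot (veval x a) (veval x b) = 0.
Proof. by case/orP=> /factor_of_dot; rewrite // dotC. Qed.

Section Solved.
Variables (p : nat) (t : seq nat) (st : state).
Hypothesis ok : solved_ok t st.
Hypothesis conds0 : all (fun s => seval x s != 0) (solved_conds p t st).
Let o k := veval x (lookup st k).

Lemma solved_triangle : triangle o.
Proof.
move=> i j i3 j3; have [<-{j j3}|ij] := eqVneq i j.
  move: conds0; rewrite all_cat => /andP[/allP h _]; apply: negbTE.
  by apply: h _ (map_f (fun i => SDot (lookup st i) (lookup st (3 + i))) _);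
    rewrite mem_iota.
case/and3P: ok => _ /allP/(_ i) h _; move: h; rewrite mem_iota.
move=> /(_ i3)/allP/(_ j); rewrite mem_iota (negPf ij) => /(_ j3) h.
by apply/eqP/incident_dot.
Qed.

Lemma solved_meets : meets x t o.
Proof.
move=> i i6; case/and3P: ok => /allP/(_ i) h _ _; move: h.
by rewrite mem_iota => /(_ i6)/factor_of_dot.
Qed.

(** The constructed objects are nonzero by [solved_triangle], which discharges the guard in
    [derived]. *)
Lemma solved_unique (o' : nat -> vec K) :
  solve t 6 [::] = Solved st -> triangle o' -> meets x t o' -> similar o' o.
Proof.
move=> hs ho' ht' k k6.
have /(_ _) := @solve_sound t 6 [::] o' ho' ht'; rewrite hs => /(_ _) h.
have {}h : derived o' st by apply: h.
have kst : (k, lookup st k) \in st.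
  by apply: lookup_in; case/and3P: ok => _ _ /allP; apply; rewrite mem_iota.
exact: h kst (triangle_neq0 solved_triangle k6).
Qed.

End Solved.

Lemma nonincidences_sep p t t' (e : nat -> vexpr) (o : nat -> vec K) :
  all (fun s => seval x s != 0) (nonincidences p t e) ->
  (forall i, (i < 6)%N -> (nth 0%N t' i \in targets p i)) ->
  similar o (fun k => veval x (e k)) -> meets x t' o ->
  forall i, (i < 6)%N -> nth 0%N t' i = nth 0%N t i.
Proof.
move=> /allP h ht' ho mo i i6; apply/eqP; apply: contraT => ne.
have k6 : (nth 0%N t' i < 6)%N.
  have := ht' i i6; rewrite /targets.
  case: ifP => _; rewrite mem_iota => /andP[] //.
  by move=> _ /leq_trans->.
have /h : SDot (VIn i) (e (nth 0%N t' i)) \in nonincidences p t e.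
  apply/allpairsPdep; exists i, (nth 0%N t' i).
  by rewrite mem_iota mem_filter ne ht'.
by rewrite /= -(prop_dot0r _ (ho _ k6)) mo ?eqxx.
Qed.

End Solver.

Arguments solve : simpl never.

(* The closed chain vertex 0, side 1, vertex 2, side 0, vertex 1, side 2, drawn
   from a position u of the vertex 0; P i is a point of the side i and M i a
   line through the vertex i. *)
Definition chain (T : Type) (cr : T -> T -> T) (P M : nat -> T) (u : T) :
    nat -> T :=
  let s1 := cr u (P 1) in let v2 := cr s1 (M 2) in
  let s0 := cr v2 (P 0) in let v1 := cr s0 (M 1) in
  nth u [:: s0; s1; cr v1 (P 2); u; v1; v2].

Definition unstuck (t : seq nat) : bool :=
  if solve t 6 [::] is Stuck then false else true.

(** * Nondegeneracy conditions of an assignment, and the finite certificate *)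

Section PencilConditions.
Variable t : seq nat.

Definition point_on (i : nat) : vexpr := VIn (index i t).
Definition line_at (i : nat) : vexpr := VIn (index (3 + i)%N t).

(** [base0] and [base1] span the given line on which the vertex 0 moves. *)
Definition base0 := VCross (line_at 0) (line_at 1).
Definition base1 := VCross (line_at 0) (line_at 2).

Definition echain (u : vexpr) (k : nat) : vexpr :=
  chain VCross point_on line_at u k.

(* The incidence of the objects i and j of the chain, as a quadratic polynomial
   in z when the vertex 0 is z * base0 + base1. *)
Definition quad (i j : nat) : sexpr * sexpr * sexpr :=
  let a := echain base0 in let b := echain base1 in
  (SDot (a i) (a j), SAdd (SDot (a i) (b j)) (SDot (b i) (a j)),
   SDot (b i) (b j)).

(** The discriminant; as [sexpr] has no constants, [4ac] is spelled as a sum. *)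
Definition sdisc (q : sexpr * sexpr * sexpr) : sexpr :=
  let ac := SMul q.1.1 q.2 in
  SSub (SMul q.1.2 q.1.2) (SAdd (SAdd ac ac) (SAdd ac ac)).

(** The resultant of two quadratic polynomials, written in the minors of their coefficients. *)
Definition sres (q r : sexpr * sexpr * sexpr) : sexpr :=
  let ac := SSub (SMul q.1.1 r.2) (SMul r.1.1 q.2) in
  let ab := SSub (SMul q.1.1 r.1.2) (SMul r.1.1 q.1.2) in
  let bc := SSub (SMul q.1.2 r.2) (SMul r.1.2 q.2) in
  SSub (SMul ac ac) (SMul ab bc).

(** In order: closing up is truly quadratic, its roots are distinct, the three given lines are not
    concurrent, at a closing root no side contains its opposite vertex, and no given point lies on a
    given line. *)
Definition stuck_conds : seq sexpr :=
  [:: (quad 2 3).1.1; sdisc (quad 2 3); SDot base0 (line_at 2)] ++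
  [seq sres (quad 2 3) (quad i (3 + i)) | i <- iota 0 3] ++
  [seq SDot (point_on i) (line_at j) | i <- iota 0 3, j <- iota 0 3].

(** The second half says that moving a single datum leaves the stuck case; [assignment_unique]
    reduces to unstuck assignments in this way. *)
Definition stuck_ok (p : nat) : bool :=
  perm_eq t (iota 0 6) &&
  all (fun i => all (fun k => (k == nth 0%N t i) ||
      unstuck (set_nth 0%N t i k))
    (targets p i)) (iota 0 6).

End PencilConditions.

Definition conds (p : nat) (t : seq nat) : seq sexpr :=
  match solve t 6 [::] with
  | Contradiction s => [:: s]
  | Solved st => solved_conds p t st
  | Stuck => stuck_conds t
  end.

Definition assignment_ok (p : nat) (t : seq nat) : bool :=
  match solve t 6 [::] with
  | Contradiction _ => true
  | Solved st => solved_ok t st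
  | Stuck => stuck_ok t p
  end.

Definition weight (t : seq nat) : nat :=
  match solve t 6 [::] with 
    Contradiction _ => 0 | Solved _ => 1 | Stuck => 2
  end.

Definition assignments (p : nat) : seq (seq nat) :=
  foldr (fun i s => [seq a :: t | a <- targets p i, t <- s]) [:: [::]]
    (iota 0 6).

Definition relabellings : seq (seq nat) := permutations (iota 0 3).

Definition relabel (g : seq nat) (k : nat) : nat :=
  if (k < 3)%N then nth 0%N g k else (3 + nth 0%N g (k - 3))%N.

Fixpoint lexle (s t : seq nat) : bool :=
  match s, t with
  | a :: s', b :: t' => (a < b)%N || (a == b) && lexle s' t'
  | _, _ => true
  end.

Definition canonical (t : seq nat) : bool :=
  all (fun g => lexle t [seq relabel g k | k <- t]) relabellings.

Definition canonical_assignments (p : nat) : seq (seq nat) :=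
  [seq t <- assignments p | canonical t && (0 < weight t)%N].

(* (t, j) stands for the j-th triangle realising the assignment t. *)
Definition indices (p : nat) : seq (seq nat * nat) :=
  [seq (t, j) | t <- canonical_assignments p, j <- iota 0 (weight t)].

(* h is the inverse of g. *)
Definition reducible (s : seq (seq nat)) (t : seq nat) : bool :=
  (weight t == 0%N) ||
  has (fun g => has (fun h => let t' := [seq relabel g k | k <- t] in
    (t' \in s) && (t == [seq relabel h k | k <- t']))
    relabellings) relabellings.

(** For [t] in [s] this gives both that its stabiliser is trivial and that [s] contains no other
    member of its orbit. *)
Definition rigid (s : seq (seq nat)) (t : seq nat) : bool :=
  all (fun g => (g == iota 0 3) ||
    ([seq relabel g k | k <- t] \notin s)) relabellings.

(** Arbitrary small integers; what matters is that no condition vanishes at them, which the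
    certificate checks. *)
Definition witness (i : nat) : vec int :=
  nth 0 [:: (3, 7, 11); (-5, 2, 13); (17, -4, 3); (2, 19, -7); (-8, 5, 9);
    (1, -6, 23)] i.

(** A closed boolean in which the field does not occur. The witness is mapped to binary integers for
    fast evaluation; [seval_morph] carries nonvanishing back to [int] and on to the field. *)
Definition certificate (p N : nat) : bool :=
  [&& all (assignment_ok p) (assignments p),
      all (fun t => all (fun s => multihomog s &&
          (seval (vmap Z_of_int \o witness) s != 0)) (conds p t))
        (assignments p),
      all (reducible (canonical_assignments p)) (assignments p),
      all (rigid (canonical_assignments p)) (canonical_assignments p),
      uniq (indices p)
    & size (indices p) == N].

(** * The quadratic case *)

(** Eliminating the constant and the leading terms at the common root expresses two of the minors as
    [- (d * z)] and [d * z ^+ 2], with [d] the third. *)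
Lemma common_root_resultant (R : comNzRingType) (a b c a' b' c' z : R) :
  a * z ^+ 2 + b * z + c = 0 -> a' * z ^+ 2 + b' * z + c' = 0 ->
  (a * c' - a' * c) * (a * c' - a' * c) -
  (a * b' - a' * b) * (b * c' - b' * c) = 0.
Proof.
move=> q0 q0'; set d := a * b' - a' * b.
have -> : a * c' - a' * c = - (d * z).
  transitivity (a * (a' * z ^+ 2 + b' * z + c') -
                a' * (a * z ^+ 2 + b * z + c) - d * z).
    by rewrite /d; ring.
  by rewrite q0 q0' !mulr0 subrr sub0r.
have -> : b * c' - b' * c = d * z ^+ 2.
  transitivity (b * (a' * z ^+ 2 + b' * z + c') -
                b' * (a * z ^+ 2 + b * z + c) + d * z ^+ 2).
    by rewrite /d; ring.
  by rewrite q0 q0' !mulr0 subrr add0r.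
by ring.
Qed.

Lemma quadratic_roots (K : numFieldType) (a b c d z : K) :
  a != 0 -> d ^+ 2 = b * b - (a * c + a * c + (a * c + a * c)) ->
  (a * z ^+ 2 + b * z + c == 0) =
  (z == (- b + d) / (a + a)) || (z == (- b - d) / (a + a)).
Proof.
move=> a0 hd; have aa0 : a + a != 0 by rewrite -mulr2n mulrn_eq0.
rewrite -(inj_eq (mulfI aa0)) mulr0 -(inj_eq (mulfI aa0)) mulr0.
have -> : (a + a) * ((a + a) * (a * z ^+ 2 + b * z + c)) =
  a * ((z * (a + a) - (- b + d)) * (z * (a + a) - (- b - d))).
  transitivity (a * ((z * (a + a) + b) ^+ 2 -
    (b * b - (a * c + a * c + (a * c + a * c))))); first by ring.
  by rewrite -hd; ring.
rewrite !mulf_eq0 (negPf a0) !subr_eq0 /=.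
by rewrite -!(can2_eq (mulfK aa0) (divfK aa0)).
Qed.

Section Stuck.
Variables (K : numClosedFieldType) (x : nat -> vec K) (t : seq nat) (p : nat).
Hypothesis ok : stuck_ok t p.
Hypothesis conds0 : all (fun s => seval x s != 0) (stuck_conds t).

Let P i := x (index i t).
Let M i := x (index (3 + i)%N t).
Let A := cross (M 0) (M 1).
Let B := cross (M 0) (M 2).
Let D := dot A (M 2).
Let ch := chain (@cross K) P M.

Lemma veval_echain u k : veval x (echain t u k) = ch (veval x u) k.
Proof. by rewrite /echain; do 7?case: k => //= k; rewrite ?nth_nil. Qed.

(** Every step is a cross product with a fixed vector, so the chain is linear in its starting point
    and its incidences are quadratic in [z]. *)
Lemma chain_comb z u v k : ch (comb z u v) k = comb z (ch u k) (ch v k).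
Proof.
by do 7?case: k => [|k]; rewrite /ch /chain /= ?nth_nil ?cross_combl.
Qed.

Let coef i j : K * K * K :=
  (seval x (quad t i j).1.1, seval x (quad t i j).1.2, seval x (quad t i j).2).

Lemma coefE i j : coef i j =
  (dot (ch A i) (ch A j), dot (ch A i) (ch B j) + dot (ch B i) (ch A j),
   dot (ch B i) (ch B j)).
Proof. by rewrite /coef /= !veval_echain. Qed.

Lemma dot_chain z i j :
  dot (ch (comb z A B) i) (ch (comb z A B) j) =
  (coef i j).1.1 * z ^+ 2 + (coef i j).1.2 * z + (coef i j).2.
Proof.
by rewrite !chain_comb !(dot_combl, dot_combr) coefE /=; ring.
Qed.

Let a := (coef 2 3).1.1.
Let b := (coef 2 3).1.2.
Let c := (coef 2 3).2.
Let d := sqrtC (b * b - (a * c + a * c + (a * c + a * c))).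

Definition closing_root (j : nat) : K := (- b + (-1) ^+ j * d) / (a + a).

Definition closed_chain (j : nat) : nat -> vec K :=
  ch (comb (closing_root j) A B).

Lemma stuck_conds_neq0 :
  [/\ a != 0, d != 0, D != 0,
      forall i, (i < 3)%N -> seval x (sres (quad t 2 3) (quad t i (3 + i))) != 0
    & forall i j, (i < 3)%N -> (j < 3)%N -> dot (P i) (M j) != 0].
Proof.
move: conds0; rewrite /stuck_conds all_cat => /andP[/and4P[ha hd hD _]].
rewrite all_cat => /andP[/allP hr /allP hPM]; split => //.
- by rewrite sqrtC_eq0.
- move=> i i3; apply: hr.
  by apply: (map_f (fun i => sres (quad t 2 3) (quad t i (3 + i))));
    rewrite mem_iota.
move=> i j i3 j3; apply: (hPM (SDot (point_on t i) (line_at t j))).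
by apply/allpairsP; exists (i, j); rewrite !mem_iota.
Qed.

Lemma closing_rootE z :
  (dot (ch (comb z A B) 2) (ch (comb z A B) 3) == 0) =
  (z == closing_root 0) || (z == closing_root 1).
Proof.
have [a0 _ _ _ _] := stuck_conds_neq0.
rewrite dot_chain (quadratic_roots _ a0 (sqrtCK _)).
by rewrite /closing_root expr0 expr1 mul1r mulN1r.
Qed.

Lemma closing_root01 : closing_root 0 != closing_root 1.
Proof.
have [a0 d0 _ _ _] := stuck_conds_neq0.
have aa0 : a + a != 0 by rewrite -mulr2n mulrn_eq0.
rewrite (inj_eq (mulIf _)) ?invr_eq0 // (inj_eq (addrI _)) expr0 expr1 mul1r.
by rewrite mulN1r -subr_eq0 opprK -mulr2n mulrn_eq0.
Qed.

(** Five incidences hold along the chain and the sixth by the choice of the root. A side through its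
    opposite vertex would make that root common to two quadratics, against the resultant
    condition. *)
Lemma closed_chain_triangle j : (j < 2)%N -> triangle (closed_chain j).
Proof.
move=> j2; have [_ _ _ hr _] := stuck_conds_neq0.
have closed : dot (closed_chain j 2) (closed_chain j 3) = 0.
  apply/eqP; rewrite closing_rootE.
  by case: j j2 => [|[|]]; rewrite ?eqxx ?orbT.
move=> i k i3 k3; have [<-{k k3}|ik] := eqVneq i k.
  apply: negbTE; apply: contra (hr _ i3); rewrite dot_chain => /eqP q0.
  by apply/eqP; apply: common_root_resultant q0; rewrite -dot_chain.
apply/eqP; case: i i3 ik => [|[|[|]]] // _; case: k k3 => [|[|[|]]] // _ _;
  first [exact: dot_cross_l | rewrite dotC; exact: dot_cross_l | exact: closed].
Qed.

Lemma stuck_perm : uniq t /\ t =i iota 0 6.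
Proof.
case/andP: ok => h _; split; last exact: perm_mem.
by rewrite (perm_uniq h) iota_uniq.
Qed.

Lemma closed_chain_meets j : meets x t (closed_chain j).
Proof.
have [tu tm] := stuck_perm; have st : size t = 6.
  by case/andP: ok => /perm_size.
move=> i i6; have kt : nth 0%N t i \in t by rewrite mem_nth ?st.
have : (nth 0%N t i < 6)%N by move: kt; rewrite tm mem_iota.
have : index (nth 0%N t i) t = i by rewrite index_uniq ?st.
case: (nth 0%N t i) => [|[|[|[|[|[|]]]]]] // <- _; try exact: dot_cross_r.
(* What remains is the line through the vertex 0, which contains both base points. *)
rewrite /closed_chain /ch /chain /= dotC dot_combl.
by rewrite !(dotC _ (x _)) !dot_cross_l mulr0 addr0.
Qed.

(** The vertices 0 already differ: pairing with [M 1] gives [- D] for both and fixes the scalar, and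
    pairing with [M 2] then recovers the root. *)
Lemma closed_chain_dissimilar : ~ similar (closed_chain 0) (closed_chain 1).
Proof.
have [_ _ D0 _ _] := stuck_conds_neq0.
move=> /(_ 3 isT)[e _]; rewrite /closed_chain /ch /chain /= => h.
have dotM1 z : dot (comb z A B) (M 1) = - D.
  by rewrite dot_combl /D /A /B /dot /cross /=; ring.
have dotM2 z : dot (comb z A B) (M 2) = z * D.
  by rewrite dot_combl /D /A /B /dot /cross /=; ring.
have e1 : e = 1.
  have := congr1 (fun u => dot u (M 1)) h; rewrite /= dotZl !dotM1 mulrN.
  by move/oppr_inj/esym/eqP; rewrite -{2}[D]mul1r => /eqP/(mulIf D0).
have := congr1 (fun u => dot u (M 2)) h; rewrite /= dotZl !dotM2 e1 mul1r.
by move/(mulIf D0)/eqP; apply/negP/closing_root01.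
Qed.

(** Since [m] is orthogonal to [w] but not to [q], these two are not proportional and their cross
    product is nonzero. *)
Lemma chain_step (u w q m : vec K) : u != 0 -> w != 0 ->
  dot u w = 0 -> dot u q = 0 -> dot m w = 0 -> dot q m != 0 ->
  proportional u (cross w q).
Proof.
move=> u0 w0 uw uq mw qm; have /andP[q0 _] := dot_neq0 qm.
apply: orthogonal_prop => //; apply: contra_neq qm => wq.
by apply/eqP; rewrite -(prop_dot0 _ (cross0_prop wq w0 q0)) dotC mw.
Qed.

Section Unique.
Variable o : nat -> vec K.
Hypothesis o_triangle : triangle o.
Hypothesis o_meets : meets x t o.

Lemma meets_stuck k : (k < 6)%N -> dot (o k) (x (index k t)) = 0.
Proof.
move=> k6; have [_ tm] := stuck_perm.
have kt : k \in t by rewrite tm mem_iota.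
have st : size t = 6 by case/andP: ok => /perm_size.
have i6 : (index k t < 6)%N by move: kt; rewrite -index_mem st.
by rewrite dotC -{2}(nth_index 0%N kt) o_meets.
Qed.

(** Once the vertex 0 is known, the chain is forced. At each step the separating vector [m] is the
    datum used just before, and points and lines alternate, so no given point on a given line
    suffices. *)
Lemma chain_similar u : proportional (o 3) u -> similar o (ch u).
Proof.
have [_ _ _ _ hPM] := stuck_conds_neq0.
have o0 k : (k < 6)%N -> o k != 0 by apply: triangle_neq0.
have next k l w q m : (k < 6)%N -> (l < 6)%N -> l \in adj k ->
    proportional (o l) w -> dot (o k) q = 0 -> dot m w = 0 -> dot q m != 0 ->
    proportional (o k) (cross w q).
  move=> k6 l6 lk ow okq mw qm; apply: chain_step okq mw qm; first exact: o0.
    by rewrite -(prop_eq0 ow) o0.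
  by apply/eqP; rewrite -(prop_dot0r _ ow) triangle_adj.
move=> h3; have hu : dot (M 0) u = 0.
  by apply/eqP; rewrite -(prop_dot0r _ h3) dotC meets_stuck.
have h1 : proportional (o 1) (ch u 1).
  apply: (next 1 3 _ _ (M 0)) => //; first exact: meets_stuck.
  exact: hPM.
have h5 : proportional (o 5) (ch u 5).
  apply: (next 5 1 _ _ (P 1)) => //; first exact: meets_stuck.
    exact: dot_cross_r.
  by rewrite dotC; apply: hPM.
have h0 : proportional (o 0) (ch u 0).
  apply: (next 0 5 _ _ (M 2)) => //; first exact: meets_stuck.
    exact: dot_cross_r.
  exact: hPM.
have h4 : proportional (o 4) (ch u 4).
  apply: (next 4 0 _ _ (P 0)) => //; first exact: meets_stuck.
    exact: dot_cross_r.
  by rewrite dotC; apply: hPM.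
have h2 : proportional (o 2) (ch u 2).
  apply: (next 2 4 _ _ (M 1)) => //; first exact: meets_stuck.
    exact: dot_cross_r.
  exact: hPM.
by case=> [|[|[|[|[|[|]]]]]].
Qed.

Lemma closed_chain_unique : exists2 j, (j < 2)%N & similar o (closed_chain j).
Proof.
have [a0 _ D0 _ _] := stuck_conds_neq0.
have o3 : scale D (o 3) =
    comb (dot (o 3) (M 2)) A (scale (- dot (o 3) (M 1)) B).
  (* Cramer's rule in the basis of cross products of the three lines; the last term drops because
     [o 3] lies on [M 0]. *)
  transitivity (comb (dot (o 3) (M 2)) A (comb (- dot (o 3) (M 1)) B
     (scale (dot (o 3) (M 0)) (cross (M 1) (M 2))))).
    rewrite /D /A /B /scale /comb /vmap /dot /cross /=.
    by do 2?congr pair; ring.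
  by rewrite (meets_stuck (k := 3)) // /scale /comb /vmap /= !mul0r !addr0.
have oD : proportional (o 3) (scale D (o 3)) by apply: prop_sym; exists D.
have closes u : proportional (o 3) u -> dot (ch u 2) (ch u 3) == 0.
  move/chain_similar => h; rewrite -(prop_dot0 _ (h 2 isT)).
  by rewrite -(prop_dot0r _ (h 3 isT)) o_triangle.
(* The case [z] at infinity: the vertex 0 is [A], and closing up would annihilate the leading
   coefficient. *)
have [r0|r0] := eqVneq (- dot (o 3) (M 1)) 0.
  have h : proportional (o 3) A.
    exists (D^-1 * dot (o 3) (M 2)); last first.
      rewrite -scaleA; move: o3; rewrite r0 /comb /scale /vmap /= !mul0r !addr0.
      case=> <- <- <-; rewrite !mulKf //; by case: (o 3) => [[]].
    apply: contraNneq (triangle_neq0 (k := 3) o_triangle isT) => z0.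
    have {}z0 : dot (o 3) (M 2) = 0.
      by move/eqP: z0; rewrite mulf_eq0 invr_eq0 (negPf D0) => /eqP.
    rewrite -(scale_eq0 _ D0) o3 r0 z0 /comb /scale /vmap /=.
    by rewrite !mul0r !addr0 !xpair_eqE !eqxx.
  by move: a0 (closes _ h); rewrite /a coefE => /negPf /= ->.
set r := - dot (o 3) (M 1) in r0 o3.
pose z := dot (o 3) (M 2) / r.
have h : proportional (o 3) (comb z A B).
  apply: prop_trans oD _; rewrite o3; exists r => //.
  by rewrite scale_comb /z mulrC divfK.
have := closes _ h; rewrite closing_rootE => /orP[] /eqP zE;
  [exists 0 | exists 1] => //; rewrite /closed_chain -zE; exact: chain_similar.
Qed.

End Unique.
End Stuck.

(** * Assignments and the triangles that realise them *)

Lemma mem_assignments p t : (t \in assignments p) =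
  (size t == 6) && all (fun i => nth 0%N t i \in targets p i) (iota 0 6).
Proof.
rewrite /assignments; have : forall m n, (t \in foldr (fun i s =>
    [seq a :: t | a <- targets p i, t <- s]) [:: [::]] (iota m n)) =
  (size t == n) && all (fun i => nth 0%N t (i - m) \in targets p i) (iota m n).
  move=> m n; elim: n m t => [|n IH] m [|a t] //=.
    by apply/negbTE/negP => /allpairsP[[b s] /= []].
  rewrite subnn /= eqSS andbCA; rewrite (_ : all _ _ =
      all (fun i => nth 0%N t (i - m.+1) \in targets p i) (iota m.+1 n)).
    rewrite -IH; apply/allpairsP/andP => [[[b s] /= [hb hs [-> ->]]]|[ha hs]].
      by split.
    by exists (a, t).
  apply: eq_in_all => i; rewrite mem_iota => /andP[mi _].
  by rewrite -(subnSK mi).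
by move=> /(_ 0 6)->; congr andb; apply: eq_in_all => i _; rewrite subn0.
Qed.

Lemma assignmentsP p t : reflect
  (size t = 6 /\ forall i, (i < 6)%N -> nth 0%N t i \in targets p i)
  (t \in assignments p).
Proof.
rewrite mem_assignments; apply: (iffP andP) => -[/eqP st h]; split => //.
  by move=> i i6; apply: (allP h); rewrite mem_iota.
by apply/allP => i; rewrite mem_iota => i6; apply: h.
Qed.

Lemma derived_nil (K : fieldType) (x o : nat -> vec K) : derived x o [::].
Proof. by []. Qed.

Section Realisation.
Variables (K : numClosedFieldType) (x : nat -> vec K) (p : nat).
Hypothesis ok : all (assignment_ok p) (assignments p).
Hypothesis conds0 : forall t, t \in assignments p ->
  all (fun s => seval x s != 0) (conds p t).

Definition realisation (i : seq nat * nat) : nat -> vec K :=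
  if solve i.1 6 [::] is Solved st then fun k => veval x (lookup st k)
  else closed_chain x i.1 i.2.

Lemma realisationP t j : t \in assignments p -> (j < weight t)%N ->
  triangle (realisation (t, j)) /\ meets x t (realisation (t, j)).
Proof.
move=> ht; move: (allP ok _ ht) (conds0 ht); rewrite /realisation /weight.
rewrite /assignment_ok /conds /=; case: (solve _ _ _) => [s|st|] h h0 hj //.
  by split; [apply: (solved_triangle h h0) | apply: solved_meets].
by split; [apply: (closed_chain_triangle h0 hj)
  | apply: (closed_chain_meets _ h)].
Qed.

Lemma realisation_cover t (o : nat -> vec K) : t \in assignments p ->
  triangle o -> meets x t o ->
  exists2 j, (j < weight t)%N & similar o (realisation (t, j)).
Proof.
move=> ht ho mo; have := solve_sound 6 ho mo (@derived_nil _ x o).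
move: (allP ok _ ht) (conds0 ht); rewrite /realisation /weight.
rewrite /assignment_ok /conds /=; case E: (solve _ _ _) => [s|st|] h h0 hs.
- by move: h0; rewrite /= hs ?eqxx.
- by exists 0%N => //; apply: (solved_unique h h0 E ho mo).
- by have [j] := closed_chain_unique h h0 ho mo; exists j.
Qed.

Lemma realisation_dissimilar t j j' : t \in assignments p ->
  (j < weight t)%N -> (j' < weight t)%N ->
  similar (realisation (t, j)) (realisation (t, j')) -> j = j'.
Proof.
move=> ht; move: (allP ok _ ht) (conds0 ht); rewrite /realisation /weight.
rewrite /assignment_ok /conds /=; case: (solve _ _ _) => [s|st|] h h0 //.
  by case: j j' => [|?] [|?].
have ne := closed_chain_dissimilar h0.
case: j j' => [|[|?]] [|[|?]] // _ _ hs; case: ne => //.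
by move=> k k6; apply: prop_sym; apply: hs.
Qed.

(** A contradictory [t] has no triangle; for a solved one the triangle is the constructed one, where
    [nonincidences] separate [t] from [t']. *)
Lemma assignment_unique_unstuck t t' (o : nat -> vec K) :
  t \in assignments p -> t' \in assignments p ->
  unstuck t ->
  triangle o -> meets x t o -> meets x t' o -> t = t'.
Proof.
move=> ht ht' ns ho mo mo'.
have := solve_sound 6 ho mo (@derived_nil _ x o).
move: (allP ok _ ht) (conds0 ht) ns.
rewrite /unstuck /assignment_ok /conds.
case E: (solve _ _ _) => [s|st|] h h0 // _ hs.
  by move: h0; rewrite /= hs ?eqxx.
case/assignmentsP: ht => st6 _; case/assignmentsP: ht' => st6' ht'.
apply: (@eq_from_nth _ 0%N); rewrite ?st6 // => i i6; apply/esym.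
apply: nonincidences_sep ht' _ mo' _ i6.
  by move: h0; rewrite /solved_conds all_cat => /andP[_ h0]; apply: h0.
exact: (solved_unique h h0 E ho mo).
Qed.

Lemma assignment_unique t t' (o : nat -> vec K) :
  t \in assignments p -> t' \in assignments p ->
  triangle o -> meets x t o -> meets x t' o -> t = t'.
Proof.
move=> ht ht' ho mo mo'.
have := @assignment_unique_unstuck t t' o ht ht'; have := allP ok _ ht.
rewrite /assignment_ok /unstuck.
case E: (solve _ _ _) => [s|st|] h ns; try exact: ns.
case/assignmentsP: (ht) => st6 htn; case/assignmentsP: (ht') => st6' htn'.
apply: (@eq_from_nth _ 0%N); rewrite ?st6 // => i i6; apply/eqP.
(* For stuck [t], change only one place where [t'] differs. The triangle realises [t2] as well, and
   [t2] is unstuck, so uniqueness for [t2] gives [t2 = t]. *)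
apply: contraT => ne; set t2 := set_nth 0%N t i (nth 0%N t' i).
have nth2 k : nth 0%N t2 k = if k == i then nth 0%N t' i else nth 0%N t k.
  by rewrite nth_set_nth.
have ht2 : t2 \in assignments p.
  apply/assignmentsP; rewrite size_set_nth st6 (maxn_idPr _) //.
  split=> // k k6.
  by rewrite nth2; case: eqP => [->|_]; [apply: htn' | apply: htn].
have mo2 : meets x t2 o.
  by move=> k k6; rewrite nth2; case: eqP => [->|_]; [apply: mo' | apply: mo].
have ns2 : unstuck t2.
  case/andP: h => _ /allP/(_ i); rewrite mem_iota.
  move=> /(_ i6)/allP/(_ _ (htn' i i6)).
  by case/orP=> [/eqP e|//]; rewrite e eqxx in ne.
have := assignment_unique_unstuck ht2 ht ns2 ho mo2 mo.
move=> /(congr1 (nth 0%N ^~ i)).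
by rewrite nth2 eqxx => /eqP; rewrite eq_sym (negPf ne).
Qed.

End Realisation.

(** * Points, lines and tangency *)

Section Representatives.
Variables (K : fieldType) (V : vectType K).
Implicit Types P Q : proj_space V.

Lemma rep_neq0 P : rep P != 0.
Proof. by rewrite vpick0 -dimv_eq0; case: P => U /= /eqP->. Qed.

Lemma rep_spanE P : subspace_of P = <[rep P]>%VS.
Proof.
apply/esym/eqP; rewrite eqEdim -memvE memv_pick dim_vline rep_neq0.
by case: P => U /= /eqP->.
Qed.

Lemma proj_eqP P Q c : rep P = c *: rep Q -> P = Q.
Proof.
move=> h; apply/val_inj/eqP; rewrite /= eqEdim !rep_spanE !dim_vline !rep_neq0.
by rewrite andbT -memvE h memvZ ?memv_line.
Qed.

Lemma proj_spanP (v : V) : v != 0 ->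
  exists P, exists2 c, c != 0 & rep P = c *: v.
Proof.
move=> v0; have hd : \dim <[v]>%VS == 1%N by rewrite dim_vline v0.
exists (ProjSpace hd); have /vlineP[c hc] : rep (ProjSpace hd) \in <[v]>%VS.
  exact: memv_pick.
exists c => //; have := rep_neq0 (ProjSpace hd); rewrite hc.
by apply: contraNneq => ->; rewrite scale0r.
Qed.

End Representatives.

Section Coordinates.
Variable K : fieldType.

Definition point_vec (P : plane K) : vec K :=
  (rep P 0 0, rep P 0 1, rep P 0 (lift 0 1)).

Definition line_vec (l : line K) : vec K :=
  (rep l 0 0, rep l 1 0, rep l (lift 0 1) 0).

Lemma sum_ord3 (R : nmodType) (F : 'I_3 -> R) :
  \sum_(j < 3) F j = F 0 + F 1 + F (lift 0 1).
Proof.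
rewrite !big_ord_recl big_ord0 addr0 addrA.
by congr (F _ + F _ + F _); apply: val_inj.
Qed.

Lemma ord3P (Q : 'I_3 -> Prop) : Q 0 -> Q 1 -> Q (lift 0 1) -> forall j, Q j.
Proof.
move=> q0 q1 q2 [[|[|[|]]] // h].
- by rewrite (_ : Ordinal h = 0) //; apply: val_inj.
- by rewrite (_ : Ordinal h = 1) //; apply: val_inj.
- by rewrite (_ : Ordinal h = lift 0 1) //; apply: val_inj.
Qed.

Lemma on_lineE P l : on_line P l = (dot (point_vec P) (line_vec l) == 0).
Proof.
rewrite /on_line.
have -> : rep P *m rep l = (dot (point_vec P) (line_vec l))%:M.
  by apply/matrixP => i j; rewrite !ord1 !mxE sum_ord3 eqxx mulr1n.
apply/eqP/eqP => [/matrixP/(_ 0 0)|->]; last first.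
  by apply/matrixP => i j; rewrite !mxE mul0rn.
by rewrite !mxE eqxx mulr1n.
Qed.

Lemma point_vec_neq0 P : point_vec P != 0.
Proof.
apply: contra_neq (rep_neq0 P) => -[h0 h1 h2]; apply/matrixP => i j.
by rewrite ord1 mxE; elim/ord3P: j.
Qed.

Lemma line_vec_neq0 l : line_vec l != 0.
Proof.
apply: contra_neq (rep_neq0 l) => -[h0 h1 h2]; apply/matrixP => j i.
by rewrite ord1 mxE; elim/ord3P: j.
Qed.

Lemma point_vec_inj P Q : proportional (point_vec P) (point_vec Q) -> P = Q.
Proof.
case=> c _ [h0 h1 h2]; apply: (@proj_eqP _ _ _ _ c); apply/matrixP => i j.
by rewrite ord1 mxE; elim/ord3P: j.
Qed.

Lemma line_vec_inj l m : proportional (line_vec l) (line_vec m) -> l = m.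
Proof.
case=> c _ [h0 h1 h2]; apply: (@proj_eqP _ _ _ _ c); apply/matrixP => j i.
by rewrite ord1 mxE; elim/ord3P: j.
Qed.

Lemma point_vecP (u : vec K) : u != 0 ->
  exists P, proportional (point_vec P) u.
Proof.
move=> u0; pose v : 'rV[K]_3 := \row_j [:: u.1.1; u.1.2; u.2]`_j.
have v0 : v != 0.
  apply: contra_neq u0 => /matrixP h; move: (h 0 0) (h 0 1) (h 0 (lift 0 1)).
  by rewrite !mxE /=; case: (u) => [[? ?] ?] /= -> -> ->.
have [P [c c0 hP]] := proj_spanP v0.
by exists P, c; rewrite // /point_vec hP !mxE.
Qed.

Lemma line_vecP (u : vec K) : u != 0 -> exists l, proportional (line_vec l) u.
Proof.
move=> u0; pose v : 'cV[K]_3 := \col_j [:: u.1.1; u.1.2; u.2]`_j.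
have v0 : v != 0.
  apply: contra_neq u0 => /matrixP h; move: (h 0 0) (h 1 0) (h (lift 0 1) 0).
  by rewrite !mxE /=; case: (u) => [[? ?] ?] /= -> -> ->.
have [l [c c0 hl]] := proj_spanP v0.
by exists l, c; rewrite // /line_vec hl !mxE.
Qed.

Lemma meet_exists l m : l != m ->
  exists2 P, proportional (point_vec P) (cross (line_vec l) (line_vec m)) &
    on_line P l && on_line P m.
Proof.
move=> lm; have lm0 : cross (line_vec l) (line_vec m) != 0.
  apply: contra_neq lm => h; apply: line_vec_inj.
  by apply: cross0_prop; rewrite ?line_vec_neq0.
have [P hP] := point_vecP lm0; exists P => //.
rewrite !on_lineE !(prop_dot0 _ hP) !(dotC (cross _ _)).
by rewrite dot_cross_l dot_cross_r !eqxx.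
Qed.

Lemma meet_unique P l m : l != m -> on_line P l -> on_line P m ->
  proportional (point_vec P) (cross (line_vec l) (line_vec m)).
Proof.
move=> lm Pl Pm; have [Q hQ /andP[Ql Qm]] := meet_exists lm.
apply: orthogonal_prop; first exact: point_vec_neq0.
- by apply/eqP; rewrite -on_lineE.
- by apply/eqP; rewrite -on_lineE.
by rewrite -(prop_eq0 hQ) point_vec_neq0.
Qed.

Lemma other_point (P : plane K) (L : line K) : on_line P L ->
  exists2 Q, on_line Q L & Q != P.
Proof.
move=> PL; have [m Pm] : exists m, ~~ on_line P m.
  have [e [e0 he]] : exists e : vec K, e != 0 /\ dot (point_vec P) e != 0.
    have := point_vec_neq0 P; case: (point_vec P) => [[a b] c].
    rewrite !xpair_eqE !negb_and -orbA => /or3P[] h;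
      [exists (1, 0, 0) | exists (0, 1, 0) | exists (0, 0, 1)];
      by rewrite !xpair_eqE !eqxx !oner_eq0 ?andbF /dot /=
        !(mulr0, mulr1, addr0, add0r).
  have [m hm] := line_vecP e0; exists m.
  by rewrite on_lineE (prop_dot0r _ hm).
have Lm : L != m by apply: contraNneq Pm => <-.
have [Q _ /andP[QL Qm]] := meet_exists Lm; exists Q => //.
by apply: contraNneq Pm => <-.
Qed.

End Coordinates.

Section Tangency.
Variable K : fieldType.
Implicit Types (P Q : plane K) (l m L : line K) (A : {fset line K}).

Lemma line_restriction_prod A (v w : 'rV[K]_3) :
  line_restriction (arrangement_eqn A) v w =
  \prod_(l <- A) line_restriction (line_eqn l) v w.
Proof. exact: rmorph_prod. Qed.

Lemma line_restriction_line l P Q :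
  line_restriction (line_eqn l) (rep P) (rep Q) =
  (dot (point_vec P) (line_vec l))%:P + dot (point_vec Q) (line_vec l) *: 'X.
Proof.
rewrite /line_restriction /line_eqn raddf_sum /= sum_ord3 !mmapZ !mmapX !mmap1U.
rewrite /dot /= !(polyCD, polyCM, scalerDl) -!mul_polyC !polyCM; ring.
Qed.

Lemma dvdp_X (p : {poly K}) : ('X %| p) = (p.[0] == 0).
Proof. by rewrite -['X]subr0 -polyC0 dvdp_XsubCl. Qed.

Lemma restriction0 A P Q :
  ((\prod_(l <- A) line_restriction (line_eqn l) (rep P) (rep Q)).[0] == 0) =
  has (on_line P) A.
Proof.
rewrite horner_prod prodf_seq_eq0; apply: eq_has => l /=.
by rewrite line_restriction_line !hornerE ?mulr0 ?addr0 on_lineE.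
Qed.

(** When [L] is not in [A], each line of [A] through [P] contributes exactly one factor ['X] to the
    restriction, and the others contribute none. *)
Lemma tangent_toP A L : (1 < #|` A|)%N -> tangent_to A L <->
  exists P l m, [/\ l \in A, m \in A, l != m &
    [&& on_line P l, on_line P m & on_line P L]].
Proof.
move=> A2; split=> [[P PL [Q [QL QP]]]|[P [l [m [lA mA lm /and3P[Pl Pm PL]]]]]].
  rewrite line_restriction_prod => dvd.
  (* If [L] belongs to [A] the restriction is zero and [P] may be no vertex; the meet of [L] with
     another line of [A] replaces it. *)
  have [LA|LA] := boolP (L \in A).
    have : (A `\ L)%fset != fset0.
      by move: A2; rewrite -cardfs_gt0 (cardfsD1 L) LA.
    case/fset0Pn => m; rewrite !inE => /andP[mL mA].
    have [P0 _ /andP[P0L P0m]] : exists2 P0,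
        proportional (point_vec P0) (cross (line_vec L) (line_vec m)) &
        on_line P0 L && on_line P0 m by apply: meet_exists; rewrite eq_sym.
    by exists P0, L, m; rewrite eq_sym LA mA mL P0L P0m.
  have /hasP[l lA Pl] : has (on_line P) A.
    rewrite -(restriction0 A P Q) -dvdp_X; apply: dvdp_trans dvd.
    by rewrite expr2 dvdp_mulr.
  have lL : l != L by apply: contraNneq LA => <-.
  have Ql : dot (point_vec Q) (line_vec l) != 0.
    rewrite -on_lineE; apply: contraNN QP => Ql; apply/eqP/point_vec_inj.
    apply: prop_trans (meet_unique lL Ql QL) _; apply: prop_sym.
    exact: meet_unique.
  move: dvd; rewrite (big_fsetD1 l) //= line_restriction_line.
  move: Pl; rewrite on_lineE => /[dup] Pl /eqP->.
  rewrite add0r -scalerAl dvdpZr // expr2 dvdp_mul2l ?polyX_eq0 // dvdp_X.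
  rewrite restriction0 => /hasP[m]; rewrite !inE => /andP[ml mA] Pm.
  by exists P, l, m; rewrite lA mA eq_sym ml PL Pm on_lineE Pl.
exists P => //; have [Q QL QP] := other_point PL; exists Q; split=> //.
have factor k : on_line P k ->
    'X %| line_restriction (line_eqn k) (rep P) (rep Q).
  rewrite on_lineE line_restriction_line => /eqP->.
  by rewrite add0r -mul_polyC dvdp_mulIr.
rewrite line_restriction_prod (big_fsetD1 l) //= (big_fsetD1 m) /=; last first.
  by rewrite !inE eq_sym lm.
by rewrite mulrA dvdp_mulr // expr2 dvdp_mul // factor.
Qed.

End Tangency.

(** * Generic arrangements as labelled triangles up to relabelling *)

Lemma mem_relabellings a b c : (a < 3)%N -> (b < 3)%N -> (c < 3)%N ->
  a != b -> a != c -> b != c -> [:: a; b; c] \in relabellings.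
Proof.
by case: a => [|[|[|]]] // _; case: b => [|[|[|]]] // _;
  case: c => [|[|[|]]].
Qed.

Section TriangleSides.
Variable K : fieldType.
Implicit Types (o : nat -> vec K) (A : {fset line K}).

Lemma prop_triangle_inj o i j : triangle o -> (i < 3)%N -> (j < 3)%N ->
  proportional (o i) (o j) -> i = j.
Proof.
move=> ho i3 j3 h; have := prop_dot0 (o (3 + i)%N) h.
by rewrite !ho // eqxx /= => /esym/negbFE/eqP.
Qed.

Lemma sides_cross_neq0 o i j : triangle o -> (i < 3)%N -> (j < 3)%N ->
  i != j -> cross (o i) (o j) != 0.
Proof.
move=> ho i3 j3; apply: contra_neq => h.
have o0 k : (k < 3)%N -> o k != 0.
  by move=> k3; apply: (triangle_neq0 ho); apply: ltn_trans k3 _.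
by apply: (prop_triangle_inj ho i3 j3); apply: cross0_prop h _ _; apply: o0.
Qed.

Lemma vertex_prop o k u : triangle o -> (k < 3)%N -> u != 0 ->
  (forall i, (i < 3)%N -> i != k -> dot u (o i) = 0) ->
  proportional u (o (3 + k)%N).
Proof.
move=> ho k3 u0 hu.
have [i [j [i3 j3 ij /andP[ik jk]]]] : exists i j,
    [/\ (i < 3)%N, (j < 3)%N, i != j & (i != k) && (j != k)].
  case: k k3 {hu} => [|[|[|]]] // _.
  - by exists 1%N, 2%N.
  - by exists 0%N, 2%N.
  - by exists 0%N, 1%N.
have ij0 := sides_cross_neq0 ho i3 j3 ij.
apply: prop_trans (orthogonal_prop u0 (hu i i3 ik) (hu j j3 jk) ij0) _.
apply: prop_sym; apply: orthogonal_prop ij0.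
- by apply: (triangle_neq0 ho); move: k3; rewrite -(ltn_add2l 3).
- by apply/eqP; rewrite dotC ho.
- by apply/eqP; rewrite dotC ho.
Qed.

(** A nonzero such [u] would be the vertex opposite to side 0, yet lie on side 0. *)
Lemma triangle_free o u : triangle o ->
  (forall k, (k < 3)%N -> dot u (o k) = 0) -> u = 0.
Proof.
move=> ho hu; apply/eqP; apply: contraT => u0.
have h : proportional u (o 3) by apply: (vertex_prop (k := 0) ho) => // i /hu.
by have := prop_dot0 (o 0) h; rewrite (hu 0) // eqxx dotC (ho 0%N 0%N) // eqxx.
Qed.

Definition col_of (u : vec K) : 'cV[K]_3 :=
  \col_j [:: u.1.1; u.1.2; u.2]`_j.

(** [insub] discards zero vectors, so the definition makes sense for every [o]. *)
Definition sides o : {fset line K} :=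
  [fset l in pmap (insub : {vspace 'cV[K]_3} -> option (line K))
    [seq <[col_of (o k)]>%VS | k <- iota 0 3]]%fset.

Lemma rep_line_vec (l : line K) c u :
  line_vec l = scale c u <-> rep l = c *: col_of u.
Proof.
split=> [[h0 h1 h2]|h]; last by rewrite /line_vec h !mxE.
by apply/matrixP => j i; rewrite ord1 !mxE; elim/ord3P: j.
Qed.

Lemma mem_sides o l : triangle o ->
  (l \in sides o) <-> (exists2 k, (k < 3)%N & proportional (line_vec l) (o k)).
Proof.
move=> ho; rewrite !inE mem_pmap; split=> [/mapP[U]|[k k3 [c c0 hl]]].
  case/mapP=> k; rewrite mem_iota => /andP[_ k3] ->.
  case: insubP => // l' _ hl' [->]; exists k => //.
  have : rep l' \in <[col_of (o k)]>%VS by rewrite -hl'; apply: memv_pick.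
  case/vlineP=> c /rep_line_vec hc; exists c => //.
  apply: contraNneq (line_vec_neq0 l') => c0; rewrite hc c0 /scale /vmap /=.
  by rewrite !mul0r.
apply/mapP; exists (subspace_of l); last by rewrite valK.
apply/mapP; exists k; rewrite ?mem_iota // rep_spanE.
move/rep_line_vec: hl => hl; apply/eqP.
by rewrite eqEdim -memvE {1}hl memvZ ?memv_line // !dim_vline rep_neq0 leq_b1.
Qed.

Lemma sub_similar_sides o o' : triangle o -> triangle o' -> similar o o' ->
  {subset sides o <= sides o'}.
Proof.
move=> ho ho' h l /(mem_sides _ ho)[k k3 hk]; apply/(mem_sides _ ho').
by exists k => //; apply: prop_trans hk _; apply: h; apply: ltn_trans k3 _.
Qed.

Lemma similar_sides o o' : triangle o -> triangle o' -> similar o o' ->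
  sides o = sides o'.
Proof.
move=> ho ho' h; apply/fsetP => l.
apply/idP/idP; apply: sub_similar_sides => //.
by move=> k k6; apply: prop_sym; apply: h.
Qed.

Lemma side_lines o : triangle o -> exists L : nat -> line K,
  [/\ forall k, (k < 3)%N -> proportional (line_vec (L k)) (o k),
      forall i j, (i < 3)%N -> (j < 3)%N -> L i = L j -> i = j
    & forall l, (l \in sides o) = (l \in [seq L k | k <- iota 0 3])].
Proof.
move=> ho; have [L hL] : exists L : nat -> line K,
    forall k, (k < 3)%N -> proportional (line_vec (L k)) (o k).
  have [l0 h0] := line_vecP (triangle_neq0 (k := 0) ho isT).
  have [l1 h1] := line_vecP (triangle_neq0 (k := 1) ho isT).
  have [l2 h2] := line_vecP (triangle_neq0 (k := 2) ho isT).
  by exists (nth l0 [:: l0; l1; l2]) => -[|[|[|]]].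
exists L; split=> //.
  move=> i j i3 j3 e; apply: (prop_triangle_inj ho i3 j3).
  by apply: prop_trans (prop_sym (hL i i3)) _; rewrite e; apply: hL.
move=> l; apply/idP/idP => [/(mem_sides _ ho)[k k3 hk]|].
  have -> : l = L k.
    by apply: line_vec_inj; apply: prop_trans hk (prop_sym _); apply: hL.
  by apply: map_f; rewrite mem_iota.
case/mapP=> k; rewrite mem_iota => k3 ->; apply/(mem_sides _ ho).
by exists k => //; apply: hL.
Qed.

Lemma generic_sides o : triangle o -> generic_arrangement 3 (sides o).
Proof.
move=> ho; have [L [hL injL mL]] := side_lines ho.
have card3 : #|` sides o|%fset = 3.
  have -> : sides o = [fset l in [seq L k | k <- iota 0 3]]%fset.
    by apply/fsetP => l; rewrite mL in_fset.
  rewrite card_fseq undup_id ?size_map // map_inj_in_uniq // => i j.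
  by rewrite !mem_iota => i3 j3; apply: injL.
split=> // P; rewrite leqNgt; apply/negP => h.
have hP : [fset l in sides o | on_line P l]%fset = sides o.
  apply/eqP; rewrite eqEfcard card3 h andbT; apply/fsubsetP => l.
  by rewrite !inE => /andP[].
case/eqP: (point_vec_neq0 P); apply: (triangle_free ho) => k k3.
have : L k \in [fset l in sides o | on_line P l]%fset.
  by rewrite hP mL; apply: map_f; rewrite mem_iota.
by rewrite !inE => /andP[_]; rewrite on_lineE (prop_dot0r _ (hL k k3)) => /eqP.
Qed.

(** The vertices are the pairwise meets. Were the lines concurrent, all three would pass through one
    point, against the bound 2; so the triple product is nonzero. *)
Lemma generic_triangle A : generic_arrangement 3 A ->
  exists2 o, triangle o & A = sides o.
Proof.
case=> A3 _ hA; have [a [b [c [hm nab nac nbc]]]] : exists a b c,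
    [/\ A =i [:: a; b; c], a != b, a != c & b != c].
  move: A3 (fset_uniq A); case EA: (enum_fset A) => [|a [|b [|c [|]]]] //= _.
  rewrite !inE negb_or andbT => /andP[/andP[ab ac] bc].
  by exists a, b, c; split; [rewrite -EA; exact: frefl | exact: ab
    | exact: ac | exact: bc].
pose v := @line_vec K; pose o := nth 0 [:: v a; v b; v c;
  cross (v b) (v c); cross (v c) (v a); cross (v a) (v b)].
have abc0 : dot (v c) (cross (v a) (v b)) != 0.
  have [P hP /andP[Pa Pb]] := meet_exists nab; rewrite dotC -(prop_dot0 _ hP).
  rewrite -on_lineE; apply/negP => Pc.
  suff /fsubset_leq_card : (A `<=` [fset l in A | on_line P l])%fset.
    by rewrite A3 => /leq_trans/(_ (hA P)).
  apply/fsubsetP => l lA; rewrite !inE lA /=; move: lA; rewrite hm !inE.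
  by case/or3P=> /eqP->.
have ho : triangle o.
  case=> [|[|[|]]] // [|[|[|]]] // _ _; rewrite /o /=;
    rewrite ?dot_cross_l ?dot_cross_r ?eqxx //; apply: negbTE.
  - by rewrite -dot_cross_rot.
  - by rewrite dot_cross_rot.
  - by [].
exists o => //; apply/fsetP => l; apply/idP/idP => [|/(mem_sides _ ho)[k k3]].
  move=> lA; apply/(mem_sides _ ho); move: lA; rewrite hm !inE.
  by case/or3P=> /eqP->; [exists 0%N | exists 1%N | exists 2]; rewrite //;
    apply: prop_refl.
rewrite hm; case: k k3 => [|[|[|//]]] _ /line_vec_inj ->;
  by rewrite !in_cons eqxx ?orbT.
Qed.

(** Matching equal lines permutes the sides, which are pairwise distinct; the vertices follow, being
    meets of sides. *)
Lemma sides_relabelling o o' : triangle o -> triangle o' ->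
  sides o = sides o' ->
  exists2 g, g \in relabellings & similar o' (o \o relabel g).
Proof.
move=> ho ho' e; have [L [hL _ mL]] := side_lines ho'.
have ex k : (k < 3)%N -> exists2 i, (i < 3)%N & proportional (o' k) (o i).
  move=> k3; have : L k \in sides o.
    by rewrite e mL; apply: map_f; rewrite mem_iota.
  case/(mem_sides _ ho)=> i i3 hi; exists i => //.
  by apply: prop_trans (prop_sym (hL k k3)) hi.
have [g0 g03 h0] := ex 0%N isT; have [g1 g13 h1] := ex 1%N isT.
have [g2 g23 h2] := ex 2 isT; pose g := [:: g0; g1; g2].
have hg k : (k < 3)%N -> proportional (o' k) (o (nth 0%N g k)).
  by case: k => [|[|[|]]].
have inj i j : (i < 3)%N -> (j < 3)%N -> nth 0%N g i = nth 0%N g j -> i = j.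
  move=> i3 j3 eg; apply: (prop_triangle_inj ho' i3 j3).
  by apply: prop_trans (hg i i3) _; rewrite eg; apply: prop_sym; apply: hg.
have gP : g \in relabellings.
  by apply: mem_relabellings => //; apply/eqP;
    [move/(inj 0 1)%N | move/(inj 0 2)%N | move/(inj 1 2)%N] => /(_ isT isT).
exists g => // k k6; rewrite /= /relabel; case: ltnP => k3; first exact: hg.
have k33 : (k - 3 < 3)%N by rewrite ltn_subLR.
have g3 i : (i < 3)%N -> (nth 0%N g i < 3)%N by case: i => [|[|[|]]].
rewrite -{1}(subnKC k3); apply: prop_sym; apply: vertex_prop => //.
  by apply: (triangle_neq0 ho); move: (g3 _ k33); rewrite -(ltn_add2l 3).
move=> i i3 ik; apply/eqP; rewrite (prop_dot0r _ (hg i i3)) dotC ho ?g3 //.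
by apply: contra ik => /eqP /(inj _ _ i3 k33) ->.
Qed.

Lemma relabelP g : g \in relabellings ->
  [/\ size g = 3, uniq g & forall k, (k \in g) = (k < 3)%N].
Proof.
rewrite mem_permutations => h; split.
- by rewrite (perm_size h).
- by rewrite (perm_uniq h).
by move=> k; rewrite (perm_mem h) mem_iota.
Qed.

Lemma relabel_triangle o g : g \in relabellings -> triangle o ->
  triangle (o \o relabel g).
Proof.
case/relabelP=> sg ug mg ho i j i3 j3; rewrite /= /relabel i3 /= addKn.
rewrite ho ?nth_uniq ?sg //; by rewrite -mg mem_nth ?sg.
Qed.

Lemma relabel_sides o g : g \in relabellings -> triangle o ->
  sides (o \o relabel g) = sides o.
Proof.
move=> hg ho; have ho' := relabel_triangle hg ho.
case/relabelP: hg => sg ug mg; apply/fsetP => l; apply/idP/idP.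
  case/(mem_sides _ ho')=> k k3; rewrite /= /relabel k3 => h.
  by apply/(mem_sides _ ho); exists (nth 0%N g k); rewrite // -mg mem_nth ?sg.
case/(mem_sides _ ho)=> k k3 h; apply/(mem_sides _ ho').
have kg : k \in g by rewrite mg.
have i3 : (index k g < 3)%N by move: kg; rewrite -index_mem sg.
by exists (index k g); rewrite //= /relabel i3 nth_index.
Qed.

Lemma relabel_meets (x : nat -> vec K) o g t : size t = 6 ->
  meets x t (o \o relabel g) <-> meets x [seq relabel g k | k <- t] o.
Proof.
by move=> st; split=> h i i6; have := h i i6; rewrite (nth_map 0%N) ?st.
Qed.

End TriangleSides.

(** * Counting *)

Section ConfigurationData.
Variables (K : fieldType) (p q : nat).
Hypothesis pq6 : (p + q = 6)%N.

Definition data_vec (c : config K p q) (i : nat) : vec K :=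
  if insub i : option 'I_(p + q) is Some i' then
    (coords c i' 0, coords c i' 1, coords c i' (lift 0 1))
  else 0.

Lemma data_vec_point (c : config K p q) (i : 'I_p) :
  data_vec c i = point_vec (tnth c.1 i).
Proof.
rewrite /data_vec; case: insubP => [i' _ hi|]; last first.
  by rewrite (leq_trans (ltn_ord i)) ?leq_addr.
rewrite (_ : i' = lshift q i); last exact: val_inj.
by rewrite /coords /point_vec !col_mxEu !mxE.
Qed.

Lemma data_vec_line (c : config K p q) (i : 'I_q) :
  data_vec c (p + i)%N = line_vec (tnth c.2 i).
Proof.
rewrite /data_vec; case: insubP => [i' _ hi|]; last first.
  by rewrite ltn_add2l ltn_ord.
rewrite (_ : i' = rshift p i); last exact: val_inj.
by rewrite /coords /line_vec !col_mxEd !mxE.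
Qed.

Lemma sides_solution (c : config K p q) o t : triangle o ->
  t \in assignments p -> meets (data_vec c) t o -> solution 3 c (sides o).
Proof.
move=> ho /assignmentsP[st ht] mo; have gen := generic_sides ho.
have [L [hL injL mL]] := side_lines ho.
have LA k : (k < 3)%N -> L k \in sides o.
  by move=> k3; rewrite mL; apply: map_f; rewrite mem_iota.
split=> // [P /tnthP[i ->]|M /tnthP[i ->]].
  have i6 : (i < 6)%N by rewrite -pq6 (leq_trans (ltn_ord i)) ?leq_addr.
  have := ht i i6; rewrite /targets ltn_ord mem_iota => k3.
  exists (L (nth 0%N t i)); first exact: LA.
  by rewrite on_lineE (prop_dot0r _ (hL _ k3)) -data_vec_point mo.
have i6 : (p + i < 6)%N by rewrite -pq6 ltn_add2l.
have := ht _ i6; rewrite /targets ltnNge leq_addr mem_iota => /andP[k3 k6].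
set k := nth _ _ _ in k3 k6; have k33 : (k - 3 < 3)%N by rewrite ltn_subLR.
apply/tangent_toP; first by case: gen => ->.
have [P hP] := point_vecP (triangle_neq0 ho k6).
have on j : (j < 3)%N -> j != (k - 3)%N -> on_line P (L j).
  move=> j3 jk; rewrite on_lineE (prop_dot0 _ hP) (prop_dot0r _ (hL _ j3)) dotC.
  by rewrite -(subnKC k3) ho.
have PM : on_line P (tnth c.2 i).
  by rewrite on_lineE (prop_dot0 _ hP) -data_vec_line dotC mo.
have [a [b [a3 b3 ab /andP[ak bk]]]] : exists a b,
    [/\ (a < 3)%N, (b < 3)%N, a != b & (a != k - 3)%N && (b != k - 3)%N].
  case: (k - 3)%N k33 => [|[|[|]]] // _.
  - by exists 1%N, 2%N.
  - by exists 0%N, 2%N.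
  - by exists 0%N, 1%N.
exists P, (L a), (L b); rewrite !LA //; split=> //.
  by apply: contra_neq ab; apply: injL.
by rewrite !on.
Qed.

Lemma solution_sides (c : config K p q) A : solution 3 c A ->
  exists o t, [/\ triangle o, t \in assignments p, meets (data_vec c) t o
    & A = sides o].
Proof.
case=> gen hP hL; have [o ho eA] := generic_triangle gen.
have ex i : (i < 6)%N ->
    has (fun k => dot (data_vec c i) (o k) == 0) (targets p i).
  move=> i6; apply/hasP; rewrite /targets; case: ltnP => ip.
    have [l lA] := hP _ (mem_tnth (Ordinal ip) c.1).
    rewrite on_lineE -data_vec_point; move: lA; rewrite eA.
    move=> /(mem_sides _ ho)[k k3 hk]; rewrite (prop_dot0r _ hk) => h.
    by exists k; rewrite ?mem_iota.
  have iq : (i - p < q)%N by rewrite ltn_subLR // pq6.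
  have A3 : #|` A|%fset = 3 by case: gen.
  have /tangent_toP := hL _ (mem_tnth (Ordinal iq) c.2).
  rewrite A3 => /(_ isT)[P [l [m [lA mA lm /and3P[Pl Pm PM]]]]].
  move: lA mA PM; rewrite eA => /(mem_sides _ ho)[a a3 ha].
  move=> /(mem_sides _ ho)[b b3 hb].
  rewrite on_lineE -data_vec_line (subnKC ip : (p + Ordinal iq)%N = i) => PM.
  have ab : a != b.
    apply: contra_neq lm => ab; apply: line_vec_inj; apply: prop_trans ha _.
    by rewrite ab; apply: prop_sym.
  (* [k] is the third index: the sides [a] and [b] meet in the vertex opposite to side [k]. *)
  have [k [k3 ka kb hk]] : exists k, [/\ (k < 3)%N, k != a, k != b &
      forall j, (j < 3)%N -> j != k -> (j == a) || (j == b)].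
    case: a a3 ab {ha} => [|[|[|]]] // _; case: b b3 {hb} => [|[|[|]]] // _ _;
      by [exists 0%N; split=> // -[|[|[|]]] | exists 1%N; split=> // -[|[|[|]]]
        | exists 2%N; split=> // -[|[|[|]]]].
  exists (3 + k)%N; first by rewrite mem_iota leq_addr ltn_add2l.
  have hPk : proportional (point_vec P) (o (3 + k)%N).
    apply: vertex_prop => //; first exact: point_vec_neq0.
    move=> j j3 /(hk j j3)/orP[]/eqP->; apply/eqP.
      by rewrite -(prop_dot0r _ ha) -on_lineE.
    by rewrite -(prop_dot0r _ hb) -on_lineE.
  by rewrite dotC -(prop_dot0 _ hPk).
(* Each datum is sent to the first admissible object incident with it. *)
pose pick i := nth 0%N (targets p i)
  (find (fun k => dot (data_vec c i) (o k) == 0) (targets p i)).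
exists o, (mkseq pick 6); split=> //.
  apply/assignmentsP; rewrite size_mkseq; split=> // i i6.
  by rewrite nth_mkseq // /pick mem_nth -?has_find ?ex.
move=> i i6; rewrite nth_mkseq //; apply/eqP.
exact: (nth_find 0%N (ex i i6)).
Qed.

End ConfigurationData.

(** * The good configurations form a nonempty open set *)

Section Zariski.
Variables (K : fieldType) (p q : nat) (ss : seq sexpr).
Hypothesis ss_homog : all multihomog ss.

Lemma data_vec_vars (c : config K p q) i :
  data_vec c i =
  vmap (meval (fun k => mxvec (coords c) 0 k)) (vvars K (p + q) i).
Proof.
rewrite /data_vec /vvars; case: insubP => [i' _ _|_].
  by rewrite /vmap /= !mevalXU !mxvecE.
by rewrite /vmap /= !meval0.
Qed.

(** The complement is the zero set of a single product, whose multidegree is the sum of those of its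
    factors. *)
Lemma nonvanishing_open :
  zariski_open (fun c : config K p q =>
    all (fun s => seval (data_vec c) s != 0) ss).
Proof.
pose F : {mpoly K[(p + q) * 3]} := \prod_(s <- ss) seval (@vvars K (p + q)) s.
exists (fun G => G = F); split=> [G ->|c].
  exists (fun i => count_mem (val i) (flatten [seq sleaves s | s <- ss])).
  suff : has_mdeg F (flatten [seq sleaves s | s <- ss]) by [].
  rewrite {}/F; elim: ss ss_homog => [_|s l IH /= /andP[hs hl]].
    rewrite big_nil => m; rewrite msupp1 inE => /eqP-> i /=.
    by rewrite big1 // => j _; rewrite mnm0E.
  by rewrite big_cons; apply: mdegM; [apply: seval_mdeg | apply: IH].
have -> : (~ all (fun s => seval (data_vec c) s != 0) ss) <->
    vanishes_at F c.
  rewrite /vanishes_at /F rmorph_prod /=.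
  rewrite (eq_bigr (fun s => seval (data_vec c) s)); last first.
    move=> s _; rewrite -seval_morph; apply: eq_seval => i.
    by rewrite -data_vec_vars.
  split=> [/negP|/eqP].
    rewrite -has_predC => /hasP[s hs /= /negPn/eqP s0].
    by apply/eqP; rewrite prodf_seq_eq0; apply/hasP; exists s; rewrite ?s0 /=.
  rewrite prodf_seq_eq0 => /hasP[s hs /= /eqP s0] /allP/(_ s hs).
  by rewrite s0 eqxx.
by split=> [h G ->|]; [|apply].
Qed.

End Zariski.

(** The chosen coordinates of the witness points and lines agree with the integral ones only up to
    scalars; multihomogeneity absorbs these. *)
Lemma witness_config (K : numFieldType) p q (ss : seq sexpr) :
  (p + q = 6)%N -> all multihomog ss ->
  all (fun s => seval (vmap Z_of_int \o witness) s != 0) ss ->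
  exists c : config K p q, all (fun s => seval (data_vec c) s != 0) ss.
Proof.
move=> pq6 hh hw; pose w i : vec K := vmap intr (witness i).
have w0 i : (i < 6)%N -> w i != 0.
  by case: i => [|[|[|[|[|[|]]]]]] // _;
    rewrite /w /witness /vmap /= !xpair_eqE !intr_eq0.
have [f hf] : exists f : 'I_p -> plane K,
    forall i, proportional (point_vec (f i)) (w i).
  suff h (i : 'I_p) : exists P : plane K, proportional (point_vec P) (w i).
    exact: fin_all_exists h.
  apply: point_vecP; apply: w0.
  by rewrite -pq6 (leq_trans (ltn_ord i)) ?leq_addr.
have [g hg] : exists g : 'I_q -> line K,
    forall i, proportional (line_vec (g i)) (w (p + i)%N).
  suff h (i : 'I_q) :
      exists l : line K, proportional (line_vec l) (w (p + i)%N).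
    exact: fin_all_exists h.
  by apply: line_vecP; apply: w0; rewrite -pq6 ltn_add2l.
exists ([tuple f i | i < p], [tuple g i | i < q]).
set c := (_, _).
have hc (i : 'I_6) : exists e, e != 0 /\ data_vec c i = scale e (w i).
  case: (ltnP i p) => ip.
    have [e e0 he] := hf (Ordinal ip); exists e; split=> //.
    by rewrite (data_vec_point c (Ordinal ip)) tnth_mktuple.
  have iq : (i - p < q)%N by rewrite ltn_subLR // pq6.
  have [e e0 he] := hg (Ordinal iq); exists e; split=> //.
  have := data_vec_line c (Ordinal iq); rewrite /= subnKC // => ->.
  by rewrite tnth_mktuple he /= subnKC.
have [e he] := fin_all_exists hc.
(* Beyond the six data both vectors are 0, so any nonzero factor serves there. *)
pose e' i := if insub i : option 'I_6 is Some i' then e i' else 1.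
have e'0 i : e' i != 0.
  rewrite /e'; case: insubP => [i' _ _|_]; last exact: oner_neq0.
  by case: (he i').
have hd : data_vec c =1 (fun i => scale (e' i) (w i)).
  move=> i; rewrite /e'; case: insubP => [i' _ <-|]; first by case: (he i').
  rewrite -leqNgt => i6; rewrite scale1 /data_vec insubN; last first.
    by rewrite pq6 -leqNgt.
  by rewrite /w /witness nth_default //= /vmap /= mulr0z.
apply/allP => s hs; rewrite (eq_seval hd) seval_scale ?(allP hh) //.
rewrite mulf_neq0 //.
  by rewrite prodf_seq_neq0; apply/allP => i _; rewrite /= e'0.
rewrite (seval_morph (intr : {rmorphism int -> K})) intr_eq0.
have := allP hw s hs; rewrite (seval_morph (Z_of_int : {rmorphism int -> _})).
by apply: contra_neq => ->; rewrite rmorph0.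
Qed.

Section Count.
Variables (K : numClosedFieldType) (p q N : nat).
Hypothesis pq6 : (p + q = 6)%N.
Hypothesis cert : certificate p N.

Let all_conds := flatten [seq conds p t | t <- assignments p].

Lemma certificate_conds : all multihomog all_conds /\
  all (fun s => seval (vmap Z_of_int \o witness) s != 0) all_conds.
Proof.
case/andP: cert => _ /andP[/allP h _].
split; apply/allP => s /flatten_mapP[t /h/allP ht /ht /andP[]] //.
Qed.

Lemma relabel_assignment g t : g \in relabellings -> t \in assignments p ->
  [seq relabel g k | k <- t] \in assignments p.
Proof.
case/relabelP=> sg _ mg /assignmentsP[st ht]; apply/assignmentsP.
rewrite size_map; split=> // i i6; rewrite (nth_map 0%N) ?st //.
have := ht i i6; rewrite /targets; case: ifP => _; rewrite !mem_iota /relabel.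
  by move=> /= k3; rewrite k3 -mg mem_nth ?sg.
case/andP=> k3 k6; have k33 : (nth 0%N t i - 3 < 3)%N by rewrite ltn_subLR.
rewrite (ltnNge (nth _ _ _) 3) k3; apply/andP; split=> //.
by rewrite /= ltn_add2l -mg mem_nth ?sg.
Qed.

Lemma mem_indices i : i \in indices p <->
  i.1 \in canonical_assignments p /\ (i.2 < weight i.1)%N.
Proof.
split=> [/allpairsPdep[t [j [ht]]]|[h1 h2]]; first by rewrite mem_iota => hj ->.
by apply/allpairsPdep; exists i.1, i.2; rewrite mem_iota -surjective_pairing.
Qed.

Lemma canonical_assignment t :
  t \in canonical_assignments p -> t \in assignments p.
Proof. by rewrite mem_filter => /andP[]. Qed.

(** The realisations of [indices p] are shown to give every solution exactly once: [reducible] moves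
    any assignment to a canonical one, and [rigid] excludes repetitions. *)
Lemma count_solutions (c : config K p q) :
  all (fun s => seval (data_vec c) s != 0) all_conds ->
  number_of (solution 3 c) N.
Proof.
move=> hc; case/and5P: cert => ok _ /allP hred /allP hrig /andP[uI /eqP sI].
have conds0 t : t \in assignments p ->
    all (fun s => seval (data_vec c) s != 0) (conds p t).
  move=> ht; apply/allP => s hs; apply: (allP hc).
  by apply/flatten_mapP; exists t.
pose T := realisation (data_vec c).
have TP i : i \in indices p -> triangle (T i) /\ meets (data_vec c) i.1 (T i).
  case: i => t j /mem_indices[/= /canonical_assignment ht hj].
  exact: (realisationP ok conds0).
exists [fset A in [seq sides (T i) | i <- indices p]]%fset; split=> [A|].
  rewrite in_fset; split=> [/mapP[[t j] hi ->]|/solution_sides].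
    have [ho mo] := TP _ hi; apply: sides_solution pq6 _ _ _ ho _ mo.
    by case/mem_indices: hi => /canonical_assignment.
  move=> /(_ pq6)[o [t [ho ht mo ->]]].
  have [j0 hj0 _] := realisation_cover ok conds0 ht ho mo.
  case/orP: (hred t ht) => [/eqP w0|]; first by rewrite w0 in hj0.
  case/hasP=> g _ /hasP[h hh /andP[]]; set t' := map _ _ => ht' /eqP tE.
  have ht'A := canonical_assignment ht'.
  have ho' := relabel_triangle hh ho.
  have st' : size t' = 6 by case/assignmentsP: ht'A.
  have mo' : meets (data_vec c) t' (o \o relabel h).
    by apply/(relabel_meets _ _ _ st'); rewrite -tE.
  have [j hj hs] := realisation_cover ok conds0 ht'A ho' mo'.
  have hi : (t', j) \in indices p by apply/mem_indices.
  apply/mapP; exists (t', j) => //; have [ho'' _] := TP _ hi.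
  by rewrite -(relabel_sides hh ho); apply: similar_sides.
rewrite card_fseq undup_id ?size_map // map_inj_in_uniq // => -[t j] [t' j'].
move=> hi hi' /= e; have [ho mo] := TP _ hi; have [ho' mo'] := TP _ hi'.
case/mem_indices: (hi) => /= htc hj; case/mem_indices: (hi') => /= htc' hj'.
have ht := canonical_assignment htc; have ht' := canonical_assignment htc'.
have [g hg hs] := sides_relabelling ho ho' e.
have [st' ht'n] := assignmentsP _ _ ht'.
have lt6 k : k \in t' -> (k < 6)%N.
  case/(nthP 0%N) => i; rewrite st' => i6 <-; have := ht'n i i6.
  rewrite /targets; case: ifP => _; rewrite mem_iota => /andP[_ //].
  by move/leq_trans->.
have mg : meets (data_vec c) [seq relabel g k | k <- t'] (T (t, j)).
  apply/(relabel_meets _ _ _ st') => i i6; apply/eqP.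
  rewrite -(prop_dot0r _ (hs _ _)) ?mo' //; apply: lt6.
  by rewrite mem_nth ?st'.
(* Equal sides give [t] as the relabelling of [t'] by [g]. Both are canonical, so rigidity makes [g]
   the identity, and dissimilarity then yields [j = j']. *)
have tE := assignment_unique ok conds0 ht (relabel_assignment hg ht') ho mo mg.
have := allP (hrig t' htc') g hg; rewrite -tE htc orbF => /eqP gE.
have relabel1 k : (k < 6)%N -> relabel g k = k.
  by rewrite gE; case: k => [|[|[|[|[|[|]]]]]].
have tt' : t = t'.
  by rewrite tE -[RHS]map_id; apply/eq_in_map => k /lt6/relabel1.
subst t'; congr pair; apply: (realisation_dissimilar ok conds0 ht hj hj').
by move=> k k6; apply: prop_sym; have := hs k k6; rewrite /= relabel1.
Qed.

Lemma certified_count : characteristic_number K 3 p q N.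
Proof.
have [hh hw] := certificate_conds.
exists (fun c => all (fun s => seval (data_vec c) s != 0) all_conds); split.
- exact: nonvanishing_open.
- exact: witness_config.
- exact: count_solutions.
Qed.

End Count.

Theorem theorem11 (R : realType) :
  characteristic_number (complex R) 3 0 6 15 /\
  characteristic_number (complex R) 3 1 5 30 /\
  characteristic_number (complex R) 3 2 4 48 /\
  characteristic_number (complex R) 3 3 3 57 /\
  characteristic_number (complex R) 3 4 2 48 /\
  characteristic_number (complex R) 3 5 1 30 /\
  characteristic_number (complex R) 3 6 0 15.
Proof.
(* What is left each time is [p + q = 6] and the certificate, closed computations independent of
   [R]. *)
do 6?[split; first by apply: certified_count; vm_compute].
by apply: certified_count; vm_compute.
Qed.
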